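(* Let $\xi$ be a nonnegative-integer-valued random variable such that $\mathbb E[\xi]=1$, $\mathbb P(\xi=1)=0$, and such that there exists $a>0$ with $\mathbb E[e^{a\xi}]<\infty$. Let $T_\infty$ be a Galton--Watson tree with offspring distribution $\xi$, conditioned on being infinite. Then there exist constants $c_1,c_2>0$ such that, for every $k\ge2$ and for any $k$-variable Boolean function $f$, we have $$\exp(-c_1L(f)\log k)\ \le\ P_k[T_\infty](f)\ \le\ \exp\left(-c_2L(f)k^{-2}-\log\binom{k}{\mathrm{Ess}(f)}\right),$$ where $\mathrm{Ess}(f)$ is the number of essential variables of $f$.
   Context: The critical Galton--Watson tree conditioned on being infinite, $T_\infty$, is the following tree. Let $\hat\xi$ have the size-biased law $\mathbb P(\hat\xi=i)=i\,\mathbb P(\xi=i)$, and let $(\hat\xi_i)_{i\ge0}$ be i.i.d. copies of $\hat\xi$. $T_\infty$ has an infinite path (spine) $(u_i)_{i\ge0}$ starting at the root $u_0$; $u_i$ has $\hat\xi_i$ children, one of which is $u_{i+1}$, and the others are roots of independent unconditioned Galton--Watson trees with offspring distribution $\xi$. A $k$-variable Boolean function is a map $\{0,1\}^k\to\{0,1\}$ ($0=\mathrm{False}$, $1=\mathrm{True}$). A $k$-variable and/or tree is a finite rooted tree with no node having exactly one child, whose internal nodes are labelled by $\land$ or $\lor$ and whose leaves are labelled by literals in $\{x_1,\bar x_1,\dots,x_k,\bar x_k\}$; evaluating it from the leaves to the root gives the Boolean function $\mathrm{f}[\tau]$ it represents. The complexity $L(f)$ of a non-constant $f$ is the minimal number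 of leaves of an and/or tree representing $f$; constant functions have complexity $0$. The variable $x_i$ is essential for $f$ if $f_{|x_i=0}\ne f_{|x_i=1}$. The randomly $k$-labelled version $\hat t$ of a (random) tree $t$ is obtained, conditionally on $t$, by giving independently each internal node a uniform label in $\{\land,\lor\}$ and each leaf a uniform label in $\{x_1,\bar x_1,\dots,x_k,\bar x_k\}$. For an infinite locally finite tree $t$ with finitely many ends (equivalence classes of infinite simple paths, two paths being equivalent if their symmetric difference is finite), almost surely there is $h$ such that all finite labelled and/or trees that coincide with $\hat t$ (including labels) up to height $h$ represent the same Boolean function; this function is denoted $\mathrm{f}[\hat t]$. $P_k[T_\infty](f)$ is the probability that $\mathrm{f}[\hat T_\infty]=f$.
   Formalization: In the lower bound L(f) is replaced by max(1, L(f)): for constant f, L(f)=0 would give P_k[T_∞](f) ≥ 1, which is false since by symmetry True and False have equal probability, at most 1/2; nothing changes for non-constant f. *)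

(* Defs.v *)
From mathcomp Require Export all_boot all_order all_algebra.
From mathcomp Require Export all_classical all_reals all_analysis.

Set Implicit Arguments.
Unset Strict Implicit.
Unset Printing Implicit Defensive.

Import Order.TTheory GRing.Theory Num.Theory.

Local Open Scope classical_set_scope.
Local Open Scope ring_scope.

(* Boolean functions *)

Definition boolfun (k : nat) : Type := {ffun {ffun 'I_k -> bool} -> bool}.

Definition restrict (k : nat) (f : boolfun k) (i : 'I_k) (b : bool) :
    boolfun k :=
  [ffun x : {ffun 'I_k -> bool} => f [ffun j => if j == i then b else x j]].

Definition essential (k : nat) (f : boolfun k) (i : 'I_k) : bool :=
  restrict f i false != restrict f i true.

Definition Ess (k : nat) (f : boolfun k) : nat := #|[set i | essential f i]%SET|.

Definition constant_fun (k : nat) (f : boolfun k) : Prop :=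
  exists b : bool, forall x, f x = b.

(* And/or trees *)

Inductive connective : Type := Conj | Disj.

(* (i, true) is the literal x_i and (i, false) is its negation. *)
Definition literal (k : nat) : Type := ('I_k * bool)%type.

(* [Node c t1 t2 ts] has children t1, t2, ts: an internal node has at least two
   children. *)
Inductive aotree (k : nat) : Type :=
| Leaf of literal k
| Node of connective & aotree k & aotree k & seq (aotree k).

Fixpoint leaves (k : nat) (t : aotree k) : nat :=
  match t with
  | Leaf _ => 1
  | Node _ t1 t2 ts => leaves t1 + leaves t2 + sumn (map (@leaves k) ts)
  end%N.

Fixpoint eval (k : nat) (x : {ffun 'I_k -> bool}) (t : aotree k) : bool :=
  match t with
  | Leaf l => x l.1 == l.2
  | Node c t1 t2 ts =>
      let bs := [:: eval x t1, eval x t2 & map (eval x) ts] in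
      match c with Conj => all id bs | Disj => has id bs end
  end.

Definition fun_of_tree (k : nat) (t : aotree k) : boolfun k :=
  [ffun x => eval x t].

Definition is_min_leaves (k : nat) (f : boolfun k) (n : nat) : Prop :=
  (exists2 t : aotree k, fun_of_tree t = f & leaves t = n) /\
  (forall t : aotree k, fun_of_tree t = f -> (n <= leaves t)%N).

(* Every non-constant function is represented by some and/or tree, so the
   default value of [xget] is never used. *)
Definition complexity (k : nat) (f : boolfun k) : nat :=
  if `[< constant_fun f >] then 0%N else xget 0%N [set n | is_min_leaves f n].

(* Possibly infinite labelled plane trees, in Ulam-Harris coordinates: the root
   is [::] and the children of a vertex v are [rcons v i] for i < arity v.
   The three functions are read only at vertices of the tree, [gate] only at
   internal ones and [lit] only at leaves; elsewhere their values are junk. *)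
Record ltree (k : nat) : Type := LTree {
  arity : seq nat -> nat;
  gate : seq nat -> connective;
  lit : seq nat -> literal k }.

(* The finite tree [s] coincides, labels included, with the subtree of [t]
   rooted at [v] up to height [h] above [v].  A vertex at height exactly [h]
   must have the same status and label in both trees, not the same number of
   children. *)
Fixpoint coincide (k : nat) (h : nat) (t : ltree k) (v : seq nat)
    (s : aotree k) : Prop :=
  match s with
  | Leaf l => arity t v = 0%N /\ lit t v = l
  | Node c s1 s2 ss =>
      [/\ (0 < arity t v)%N, gate t v = c &
        match h with
        | 0%N => True
        | h'.+1 =>
            let children := [:: s1, s2 & ss] in
            arity t v = size children /\
            forall i, (i < arity t v)%N ->
              coincide h' t (rcons v i) (nth s children i)
        end]
  end.

(* f[t] = f.  Asking for one finite tree that coincides with t up to height h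
   makes f unique, also when t has a vertex with exactly one child. *)
Definition represents (k : nat) (t : ltree k) (f : boolfun k) : Prop :=
  exists h : nat,
    (exists s : aotree k, coincide h t [::] s) /\
    (forall s : aotree k, coincide h t [::] s -> fun_of_tree s = f).

(* Independence.  All random variables below take values in countable sets,
   which carry the discrete sigma-algebra. *)

Definition sigma_of (Omega E : Type) (X : Omega -> E) : set (set Omega) :=
  [set X @^-1` A | A in [set: set E]].

Definition mutually_independent (R : realType) (d : measure_display)
    (Omega : measurableType d) (P : probability Omega R) (I : eqType)
    (G : I -> set (set Omega)) : Prop :=
  forall (s : seq I) (A : I -> set Omega), uniq s ->
    (forall i, i \in s -> G i (A i)) ->
    (P (\big[setI/[set: Omega]]_(i <- s) A i) = \prod_(i <- s) P (A i))%E.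

(* One source of randomness per vertex for the number of children, one for the
   gate, one for the literal. *)
Definition source : Type := (seq nat + (seq nat + seq nat))%type.

Definition source_sigma (k : nat) (Omega : Type) (T : Omega -> ltree k)
    (i : source) : set (set Omega) :=
  match i with
  | inl v => sigma_of (fun w => arity (T w) v)
  | inr (inl v) => sigma_of (fun w => gate (T w) v)
  | inr (inr v) => sigma_of (fun w => lit (T w) v)
  end.

(* The spine u_0, u_1, ... consists of the vertices [:: 0; ...; 0]: trees being
   considered as unordered, u_{i+1} may be taken to be the first child of u_i. *)
Definition on_spine (v : seq nat) : bool := all (pred1 0%N) v.

Definition size_biased (R : realType) (mu : nat -> \bar R) (n : nat) : \bar R :=
  (n%:R%:E * mu n)%E.

(* [T] is the randomly k-labelled version of the Galton-Watson tree conditioned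
   on being infinite, where [mu n] is the probability of having n children. *)
Definition random_labelled_Tinfty (R : realType) (mu : nat -> \bar R)
    (k : nat) (d : measure_display) (Omega : measurableType d)
    (P : probability Omega R) (T : Omega -> ltree k) : Prop :=
  [/\ forall i, source_sigma T i `<=` measurable,
      mutually_independent P (source_sigma T : (source : eqType) -> _),
      forall v n, P [set w | arity (T w) v = n] =
        if on_spine v then size_biased mu n else mu n,
      forall v c, P [set w | gate (T w) v = c] = (2^-1)%:E &
      forall v l, P [set w | lit (T w) v = l] = ((2 * k)%N%:R^-1)%:E].

(* P_k[T_infty](f). *)
Definition Pk (R : realType) (k : nat) (d : measure_display)
    (Omega : measurableType d) (P : probability Omega R)
    (T : Omega -> ltree k) (f : boolfun k) : \bar R :=
  P [set w | represents (T w) f].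

(* Main.v *)
Require Import Defs.
From mathcomp Require Import fingroup perm zify ring lra.

Set Implicit Arguments.
Unset Strict Implicit.
Unset Printing Implicit Defensive.

Import Order.TTheory GRing.Theory Num.Theory.

Local Open Scope classical_set_scope.
Local Open Scope ring_scope.

(* The complexity L, with constants of complexity 0, is subadditive under gates.
   Call a vertex killed when it and its first child have m children and the same
   gate, and contradictory literals sit at leaves among their other children: the
   subtree there is constant whatever lies below, and this has probability of
   order 1/k.  Trimming at killed vertices turns the critical fringe trees into
   trees with mean offspring 1 - O(1/k), so their trimmed size has an exponential
   moment of order theta = eta^2/k^2 at most 1 + eta/k.  Along the spine, a
   killing event again has probability of order 1/k and beats the contribution of
   the fringe trees, whence P(L >= n) <= exp(-theta n) by induction on the height,
   with constant 1 in front.  The law of the tree is invariant under permutations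
   of the variables, and f has at least binomial(k, Ess f) distinct images under
   them, which gives the upper bound.  For the lower bound, a minimal tree for f is
   made m-ary by padding and grafted at the root next to a spine forced to be
   neutral; a finite pattern with n vertices has probability at least (c/k)^n.

   To deal with finite sums only, arities are capped at N + 2 and one looks at the
   labels of all the vertices of the (N+2)-ary tree up to some depth, in the tree
   or not; these labels are independent. *)

(** * Complexity of Boolean functions *)

Section AndOrTrees.
Local Open Scope nat_scope.
Variable k : nat.
Implicit Types (f g : boolfun k) (t : aotree k) (c : connective) (bs : seq bool).

Lemma aotree_nested_ind (Q : aotree k -> Prop) :
  (forall l, Q (Leaf l)) ->
  (forall c t1 t2 ts, (forall i, i < size [:: t1, t2 & ts] ->
    Q (nth t1 [:: t1, t2 & ts] i)) -> Q (Node c t1 t2 ts)) ->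
  forall t, Q t.
Proof.
move=> QL QN; fix IH 1 => -[l|c t1 t2 ts]; first exact: QL.
apply: QN.
have Qs : forall i, i < size ts -> Q (nth t1 ts i).
  elim: ts => [i|t ts IHts [_|i Hi]]; first by clear IH; rewrite ltn0.
    exact: (IH t).
  exact: (IHts i Hi).
move=> [_|[_|i Hi]]; [exact: (IH t1)|exact: (IH t2)|exact: (Qs i Hi)].
Qed.

Definition gate_eval c bs : bool :=
  match c with Conj => all id bs | Disj => has id bs end.

Definition is_conj c : bool := if c is Conj then true else false.

Lemma gate_eval_cons c b bs : gate_eval c (b :: bs) =
  if is_conj c then b && gate_eval c bs else b || gate_eval c bs.
Proof. by case: c. Qed.

Lemma gate_eval_nil c : gate_eval c [::] = is_conj c.
Proof. by case: c. Qed.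

Lemma eval_Node x c t1 t2 ts :
  eval x (Node c t1 t2 ts) = gate_eval c (map (eval x) [:: t1, t2 & ts]).
Proof. by case: c. Qed.

Lemma complexity_const f : constant_fun f -> complexity f = 0.
Proof. by move=> fc; rewrite /complexity; case: asboolP. Qed.

Lemma is_min_leaves_ex f t : fun_of_tree t = f -> exists n, is_min_leaves f n.
Proof.
move=> tf; pose Q n := `[< exists2 t, fun_of_tree t = f & leaves t = n >].
have exQ : exists n, Q n by exists (leaves t); apply/asboolP; exists t.
case: (ex_minnP exQ) => n /asboolP Qn minn; exists n; split=> // t' t'f.
by apply: minn; apply/asboolP; exists t'.
Qed.

Lemma complexity_le_leaves t : complexity (fun_of_tree t) <= leaves t.
Proof.
rewrite /complexity; case: asboolP => // _.
have [n nmin] := is_min_leaves_ex (erefl (fun_of_tree t)).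
case: xgetP => [m _ [_ mmin]|/(_ n)/(_ nmin)//]; exact: mmin.
Qed.

Lemma complexity_witness f t : fun_of_tree t = f -> ~ constant_fun f ->
  exists2 t', fun_of_tree t' = f & leaves t' = complexity f.
Proof.
move=> tf fnc; rewrite /complexity; case: asboolP => // _.
have [n nmin] := is_min_leaves_ex tf.
by case: xgetP => [m _ [[t' t'f t'm] _]|/(_ n)/(_ nmin)//]; exists t'.
Qed.

(** A gate with a single input is the identity, so a one-element list is served by its only tree: no
    node may have just one child. *)
Lemma node_of c ts : 0 < size ts ->
  exists t, leaves t = sumn (map (@leaves k) ts) /\
    forall x, eval x t = gate_eval c (map (eval x) ts).
Proof.
case: ts => [|t1 [|t2 ts]] // _.
  exists t1; split=> [|x]; first by rewrite /= addn0.
  by case: c => /=; rewrite ?andbT ?orbF.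
exists (Node c t1 t2 ts); split; first by rewrite /= addnA.
by move=> x; rewrite eval_Node.
Qed.

(* A variable is needed: without literals there is no tree at all. *)
Lemma fun_of_tree_surj (i0 : 'I_k) f : exists t, fun_of_tree t = f.
Proof.
(* Disjunctive normal form: one conjunction of literals for each point where [f] is true. *)
have minterm (y : {ffun 'I_k -> bool}) : exists t, forall x, eval x t = (x == y).
  have ne : 0 < size [seq Leaf (i, y i) | i <- enum 'I_k].
    by rewrite size_map size_enum_ord; apply: leq_ltn_trans (ltn_ord i0).
  have [t [_ tE]] := node_of Conj ne; exists t => x; rewrite tE /= all_map all_map.
  apply/allP/eqP => [H|-> i _ /=]; last by rewrite eqxx.
  by apply/ffunP => i; apply/eqP; apply: H; rewrite mem_enum.
have [g gE] := choice minterm.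
have [[y0 fy0]|f0] := pselect (exists y, f y).
  have ne : 0 < size [seq g y | y <- enum [pred y | f y]].
    by rewrite size_map -cardE; apply/card_gt0P; exists y0.
  have [t [_ tE]] := node_of Disj ne; exists t; apply/ffunP => x.
  rewrite ffunE tE /= has_map has_map.
  apply/hasP/idP => [[y]|fx]; last by exists x; rewrite ?mem_enum //= gE.
  by rewrite mem_enum inE /= gE => fy /eqP ->.
exists (Node Conj (Leaf (i0, true)) (Leaf (i0, false)) [::]).
apply/ffunP => x; rewrite ffunE /=; case fx: (f x); first by case: f0; exists x.
by case: (x i0).
Qed.

(** A constant input is either neutral, leaving the other function, or absorbing, making the result
    constant, of complexity 0. Otherwise two minimal trees are joined. *)
Lemma complexity_gate2 (i0 : 'I_k) c f g :
  complexity [ffun x => if is_conj c then f x && g x else f x || g x]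
  <= complexity f + complexity g.
Proof.
set h := finfun _.
have hE x : h x = if is_conj c then f x && g x else f x || g x by rewrite ffunE.
have eqh g' : (forall x, h x = g' x) -> h = g' by move=> H; apply/ffunP.
have [[b fb]|fnc] := pselect (constant_fun f).
  have [bc|bc] := eqVneq b (is_conj c).
    rewrite (eqh g) ?leq_addl // => x; rewrite hE fb bc.
    by case: (is_conj c).
  rewrite complexity_const //; exists b => x; rewrite hE fb.
  by move: bc; case: (is_conj c); case: b {fb}.
have [[b gb]|gnc] := pselect (constant_fun g).
  have [bc|bc] := eqVneq b (is_conj c).
    rewrite (eqh f) ?leq_addr // => x; rewrite hE gb bc.
    by case: (is_conj c); rewrite ?andbT ?orbF.
  rewrite complexity_const //; exists b => x; rewrite hE gb.
  by move: bc; case: (is_conj c); case: b {gb}; rewrite ?andbF ?orbT.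
have [t0 t0f] := fun_of_tree_surj i0 f; have [t1 t1g] := fun_of_tree_surj i0 g.
have [t tf <-] := complexity_witness t0f fnc.
have [t' t'g <-] := complexity_witness t1g gnc.
have -> : h = fun_of_tree (Node c t t' [::]).
  apply: eqh => x; rewrite hE [RHS]ffunE eval_Node /= -tf -t'g !ffunE; clear.
  by case: c => /=; rewrite ?andbT ?orbF.
by apply: leq_trans (complexity_le_leaves _) _; rewrite /= addn0.
Qed.

Lemma complexity_gate (i0 : 'I_k) c (fs : seq (boolfun k)) :
  complexity [ffun x => gate_eval c [seq (f : boolfun k) x | f <- fs]]
  <= sumn (map (@complexity k) fs).
Proof.
elim: fs => [|f fs IH] /=.
  by rewrite complexity_const //; exists (is_conj c) => x; rewrite ffunE gate_eval_nil.
apply: leq_trans (leq_add (leqnn _) IH).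
apply: leq_trans (complexity_gate2 i0 c _ _).
by apply/eq_leq; congr complexity; apply/ffunP => x; rewrite !ffunE gate_eval_cons.
Qed.

Lemma complexity_literal (l : literal k) :
  complexity [ffun x : {ffun 'I_k -> bool} => x l.1 == l.2] <= 1.
Proof.
have -> : [ffun x : {ffun 'I_k -> bool} => x l.1 == l.2] = fun_of_tree (Leaf l).
  by apply/ffunP => x; rewrite !ffunE.
exact: complexity_le_leaves.
Qed.

End AndOrTrees.

(** * Finite patterns and their weights *)

Lemma card_ord_lt (M n : nat) : (n <= M)%N -> #|[pred i : 'I_M | (i < n)%N]| = n.
Proof.
move=> le_nM; have winj : injective (widen_ord le_nM).
  by move=> i j /(congr1 val) /= /val_inj.
rewrite -[RHS]card_ord -(card_codom winj).
apply: eq_card => i; rewrite inE; apply/idP/codomP => [lt_in|[j ->]]; last exact: (ltn_ord j).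
by exists (Ordinal lt_in); apply: val_inj.
Qed.

Section Patterns.
Variables (R : realType) (k N : nat).

(* Arity, whether the gate is a conjunction, literal.  Arities are capped to at
   most N + 2. *)
Definition lab : finType := ('I_N.+3 * bool * ('I_k * bool))%type.

(* Labels of all the vertices at depth less than h of the (N+2)-ary tree; the
   first child, which carries the spine, is kept apart from the others. *)
Fixpoint pat (h : nat) : finType :=
  if h is h'.+1 then (lab * (pat h' * {ffun 'I_N.+1 -> pat h'}))%type else unit.

Definition root_lab h (s : pat h.+1) : lab := s.1.
Definition first_child h (s : pat h.+1) : pat h := s.2.1.
Definition children h (s : pat h.+1) : {ffun 'I_N.+1 -> pat h} := s.2.2.

Definition ar (x : lab) : nat := x.1.1.
Definition conj_gate (x : lab) : bool := x.1.2.

Lemma ar_lt (x : lab) : (ar x < N.+3)%N. Proof. exact: ltn_ord. Qed.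

Variable nu : bool -> 'I_N.+3 -> R.

(** [4 * k] is the number of pairs of a gate and a literal. The flag [b] says whether the vertex is
    on the spine; in [wt] only the first child inherits it. *)
Definition wlab b (x : lab) : R := nu b x.1.1 * ((4 * k)%N%:R)^-1.

Fixpoint wt b (h : nat) : pat h -> R :=
  match h return pat h -> R with
  | 0%N => fun=> 1
  | h'.+1 => fun s => wlab b s.1 * (@wt b h' s.2.1 * \prod_i @wt false h' (s.2.2 i))
  end.

Definition Ex b h (F : pat h -> R) : R := \sum_s wt b s * F s.
Definition Ech h (H : {ffun 'I_N.+1 -> pat h} -> R) : R :=
  \sum_(g : {ffun 'I_N.+1 -> pat h}) (\prod_i wt false (g i)) * H g.

Hypothesis k_gt0 : (0 < k)%N.
Hypothesis nu_ge0 : forall b n, 0 <= nu b n.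
Hypothesis nu_sum1 : forall b, \sum_n nu b n = 1.

Lemma wlab_ge0 b x : 0 <= wlab b x.
Proof. by rewrite mulr_ge0 ?invr_ge0. Qed.

Lemma wt_ge0 b h (s : pat h) : 0 <= wt b s.
Proof.
elim: h b s => [|h IH] b s //=.
by rewrite !mulr_ge0 ?wlab_ge0 // prodr_ge0.
Qed.

Lemma Ech_wt_ge0 h (g : {ffun 'I_N.+1 -> pat h}) : 0 <= \prod_i wt false (g i).
Proof. by apply: prodr_ge0 => i _; apply: wt_ge0. Qed.

Lemma eq_Ex b h (F G : pat h -> R) : F =1 G -> Ex b F = Ex b G.
Proof. by move=> FG; apply: eq_bigr => s _; rewrite FG. Qed.

Lemma le_Ex b h (F G : pat h -> R) : (forall s, F s <= G s) -> Ex b F <= Ex b G.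
Proof. by move=> FG; apply: ler_sum => s _; rewrite ler_wpM2l ?wt_ge0. Qed.

Lemma ExZ b h c (F : pat h -> R) : Ex b (fun s => c * F s) = c * Ex b F.
Proof. by rewrite /Ex mulr_sumr; apply: eq_bigr => s _; rewrite mulrCA. Qed.

Lemma ExB b h (F G : pat h -> R) : Ex b (fun s => F s - G s) = Ex b F - Ex b G.
Proof. by rewrite /Ex -sumrB; apply: eq_bigr => s _; rewrite mulrBr. Qed.

Lemma le_Ech h (F G : {ffun 'I_N.+1 -> pat h} -> R) :
  (forall g, F g <= G g) -> Ech F <= Ech G.
Proof. by move=> FG; apply: ler_sum => g _; rewrite ler_wpM2l ?Ech_wt_ge0. Qed.

Lemma Ech_prod h (H : 'I_N.+1 -> pat h -> R) :
  Ech (fun g => \prod_i H i (g i)) = \prod_i Ex false (H i).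
Proof.
rewrite [RHS]bigA_distr_bigA /=; apply: eq_bigr => g _.
by rewrite -big_split.
Qed.

Lemma ExS b h (F : pat h.+1 -> R) : Ex b F =
  \sum_x wlab b x * Ex b (fun s0 => Ech (fun g => F (x, (s0, g)))).
Proof.
transitivity (\sum_(x : lab) \sum_(y : pat h * {ffun 'I_N.+1 -> pat h})
    wlab b x * (wt b y.1 * \prod_i wt false (y.2 i)) * F (x, y)).
  by rewrite pair_bigA /=; apply: eq_bigr => -[x y].
apply: eq_bigr => x _; rewrite mulr_sumr.
transitivity (\sum_(s0 : pat h) \sum_(g : {ffun 'I_N.+1 -> pat h})
    wlab b x * (wt b s0 * \prod_i wt false (g i)) * F (x, (s0, g))).
  by rewrite pair_bigA /=; apply: eq_bigr => -[s0 g].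
apply: eq_bigr => s0 _; rewrite /Ech !mulr_sumr.
by apply: eq_bigr => g _; rewrite !mulrA.
Qed.

Lemma ExS_swap b h (F : pat h.+1 -> R) : Ex b F =
  \sum_x wlab b x * Ech (fun g => Ex b (fun s0 => F (x, (s0, g)))).
Proof.
rewrite ExS; apply: eq_bigr => x _; congr (_ * _).
rewrite /Ex /Ech; under eq_bigr do rewrite mulr_sumr.
rewrite exchange_big; apply: eq_bigr => g _; rewrite mulr_sumr.
by apply: eq_bigr => s0 _; rewrite mulrCA.
Qed.

(** Comparison conditionally on everything outside the subtree of the first child. Applied twice, it
    leaves only the subtree two steps down to average over. *)
Lemma le_ExS b h (F G : pat h.+1 -> R) :
  (forall x g, Ex b (fun s0 => F (x, (s0, g))) <= Ex b (fun s0 => G (x, (s0, g)))) ->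
  Ex b F <= Ex b G.
Proof.
move=> FG; rewrite !ExS_swap; apply: ler_sum => x _.
by rewrite ler_wpM2l ?wlab_ge0 //; apply: le_Ech => g; apply: FG.
Qed.

Lemma sum_lab_prod b (phi1 : 'I_N.+3 -> R) (phi2 : bool -> R) (phi3 : 'I_k * bool -> R) :
  \sum_x wlab b x * (phi1 x.1.1 * phi2 x.1.2 * phi3 x.2) =
  (\sum_n nu b n * phi1 n) * (\sum_c phi2 c) * (\sum_l phi3 l) / (4 * k)%N%:R.
Proof.
transitivity (\sum_(n : 'I_N.+3) \sum_(c : bool) \sum_(l : 'I_k * bool)
    wlab b (n, c, l) * (phi1 n * phi2 c * phi3 l)).
  by rewrite !pair_bigA /=; apply: eq_bigr => -[[n c] l].
rewrite -(mulrA (\sum_n _)) [X in _ * X / _]big_distrlr /= -mulrA mulr_suml.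
apply: eq_bigr => n _; rewrite mulr_suml mulr_sumr; apply: eq_bigr => c _.
rewrite mulr_suml mulr_sumr; apply: eq_bigr => l _; by rewrite /wlab /=; ring.
Qed.

Lemma sum_lab b (phi : 'I_N.+3 -> R) :
  \sum_x wlab b x * phi x.1.1 = \sum_n nu b n * phi n.
Proof.
have k4 : ((4 * k)%N%:R : R) != 0 by rewrite pnatr_eq0 muln_eq0 /= -lt0n.
transitivity (\sum_(n : 'I_N.+3) \sum_(c : bool) \sum_(l : 'I_k * bool)
    wlab b (n, c, l) * phi n).
  by rewrite !pair_bigA /=; apply: eq_bigr => -[[n c] l].
apply: eq_bigr => n _; rewrite /wlab /= !sumr_const card_prod card_ord card_bool.
rewrite -mulrnA (_ : k * 2 * 2 = 4 * k)%N; last by rewrite -mulnA mulnC.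
by rewrite -[LHS]mulr_natr mulrAC mulrVK ?unitfE.
Qed.

Lemma sum_wlab b : \sum_x wlab b x = 1.
Proof.
transitivity (\sum_x wlab b x * (fun=> 1) x.1.1).
  by apply: eq_bigr => x _; exact/esym/mulr1.
rewrite (sum_lab b (fun=> 1)) -[RHS](nu_sum1 b); by apply: eq_bigr => n _; exact: mulr1.
Qed.

Lemma Ex_cst b h c : Ex b (fun _ : pat h => c) = c.
Proof.
rewrite -[c in LHS]mulr1 ExZ -[RHS]mulr1; congr (_ * _).
elim: h b => [|h IH] b.
  by rewrite /Ex (big_pred1 tt) ?mulr1 // => -[].
rewrite ExS (eq_bigr (wlab b)) ?sum_wlab // => x _.
rewrite (@eq_Ex b h _ (fun=> 1)) ?IH ?mulr1 // => s0.
transitivity (Ech (fun g : {ffun 'I_N.+1 -> pat h} => \prod_(i < N.+1) (1 : R))).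
  by apply: eq_bigr => g _; rewrite big1_eq.
by rewrite (Ech_prod (fun=> fun=> 1)) big1.
Qed.

Lemma Ech_cst h c : Ech (fun _ : {ffun 'I_N.+1 -> pat h} => c) = c.
Proof.
transitivity (c * Ech (fun g : {ffun 'I_N.+1 -> pat h} => \prod_(i < N.+1) (1 : R))).
  rewrite /Ech mulr_sumr; apply: eq_bigr => g _; by rewrite big1_eq mulr1 mulrC.
by rewrite (Ech_prod (fun=> fun=> 1)) big1 ?mulr1 // => i _; rewrite Ex_cst.
Qed.

Lemma Ech_at h i0 (H : pat h -> R) : Ech (fun g => H (g i0)) = Ex false H.
Proof.
transitivity (Ech (fun g : {ffun 'I_N.+1 -> pat h} =>
    \prod_i (fun i s => if i == i0 then H s else 1) i (g i))).
  by apply: eq_bigr => g _; rewrite -big_mkcond big_pred1_eq.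
rewrite (Ech_prod (fun i s => if i == i0 then H s else 1)) (bigD1 i0) //=.
rewrite eqxx big1 ?mulr1 // => i /negbTE ->.
exact: Ex_cst.
Qed.

Lemma ExS_lab b h (phi : lab -> R) :
  Ex b (fun s : pat h.+1 => phi s.1) = \sum_x wlab b x * phi x.
Proof.
rewrite ExS; apply: eq_bigr => x _; congr (_ * _).
by rewrite (@eq_Ex b h _ (fun=> phi x)) ?Ex_cst // => s0; rewrite /= Ech_cst.
Qed.

Definition sub_val h (F0 F1 : pat h -> R) (z : R) (s : pat h.+1) : R :=
  if ar s.1 == 0%N then z
  else F0 s.2.1 * \prod_(i < N.+1 | (i < (ar s.1).-1)%N) F1 (s.2.2 i).

(** Probability generating function of [nu b], with the contribution of a leaf and the factor of the
    first child kept as separate arguments. *)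
Definition gen_fun b (z x0 x1 : R) : R :=
  nu b ord0 * z + \sum_(n | n != ord0) nu b n * (x0 * x1 ^+ n.-1).

(** Branching property: given an arity [n > 0], the first child and the [n.-1] others carry
    independent subtrees, and only the first keeps the flag [b]. *)
Lemma Ex_sub_val b h (F0 F1 : pat h -> R) z :
  Ex b (sub_val F0 F1 z) = gen_fun b z (Ex b F0) (Ex false F1).
Proof.
rewrite ExS /sub_val /=.
transitivity (\sum_x wlab b x * (fun n : 'I_N.+3 => if n == ord0 then z else
    Ex b F0 * Ex false F1 ^+ n.-1) x.1.1).
  apply: eq_bigr => -[[n c] l] _; congr (_ * _) => /=.
  rewrite /ar /= -[n == ord0]/(n == 0%N :> nat).
  case: (eqVneq (n : nat) 0%N) => [_|n0].
    by rewrite (@eq_Ex b h _ (fun=> z)) ?Ex_cst // => s0; rewrite /= Ech_cst.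
  rewrite mulrC -ExZ; apply: eq_Ex => s0; rewrite mulrC.
  have le_n : (n.-1 <= N.+1)%N by have := ltn_ord n; lia.
  transitivity (F0 s0 * Ech (fun g : {ffun 'I_N.+1 -> pat h} =>
      \prod_i (fun (i : 'I_N.+1) s => if (i < n.-1)%N then F1 s else 1) i (g i))).
    rewrite /Ech mulr_sumr; apply: eq_bigr => g _.
    by rewrite mulrCA (big_mkcond (fun i : 'I_N.+1 => (i < n.-1)%N)).
  congr (_ * _).
  rewrite (Ech_prod (fun (i : 'I_N.+1) s => if (i < n.-1)%N then F1 s else 1)).
  transitivity (\prod_(i < N.+1 | (i < n.-1)%N) Ex false F1).
    rewrite [RHS]big_mkcond; apply: eq_bigr => i _.
    by case: ifP => // _; rewrite Ex_cst.
  by rewrite prodr_const card_ord_lt.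
rewrite (sum_lab b (fun n : 'I_N.+3 => if n == ord0 then z else
    Ex b F0 * Ex false F1 ^+ n.-1)) (bigD1 ord0) //= /gen_fun; congr (_ + _).
by apply: eq_bigr => n /negbTE ->.
Qed.

End Patterns.

(** * Trimmed size of a pattern *)

Section Complexity_bound.
Variables (R : realType) (k N m : nat).
Local Notation pat := (pat k N).
Local Notation lab := (lab k N).
Implicit Types (b : bool).

(** [x] and [x0] label a vertex and its first child, [x1] and [x01] the second child of each. *)
Definition kill_lab (x x0 x1 x01 : lab) : bool :=
  [&& ar x == m, ar x0 == m & conj_gate x == conj_gate x0] &&
  [&& ar x1 == 0%N, ar x01 == 0%N & x01.2 == (x1.2.1, ~~ x1.2.2)].

(* The gates of s and of its first child agree and have contradictory literals
   as leaf inputs: the value at the root of s is constant, whatever the subtree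
   below [first_child (first_child s)] is. *)
Definition kill h : pat h.+2 -> bool :=
  match h return pat h.+2 -> bool with
  | 0%N => fun=> false
  | h'.+1 => fun s => kill_lab (root_lab s) (root_lab (first_child s))
      (root_lab (children s ord0)) (root_lab (children (first_child s) ord0))
  end.

Definition sum_children b h (phi : bool -> pat h -> nat) (s : pat h.+1) : nat :=
  if ar s.1 == 0%N then ~~ b : nat
  else (phi b s.2.1 + \sum_(i < N.+1 | (i < (ar s.1).-1)%N) phi false (s.2.2 i))%N.

(* Upper bound for the complexity of the function computed by a pattern of odd
   depth (the values at even depths are junk). *)
Fixpoint trimmed_size b h : pat h -> nat :=
  match h return pat h -> nat with
  | 0%N => fun=> 0%N
  | h1.+1 => match h1 return pat h1.+1 -> nat with
    | 0%N => fun=> ~~ b : nat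
    | h2.+1 => fun s => if kill s then 0%N
        else sum_children b (fun b' => sum_children b' (fun b'' => @trimmed_size b'' h2)) s
    end
  end.

Variable nu : bool -> 'I_N.+3 -> R.
Hypothesis k_gt0 : (0 < k)%N.
Hypothesis nu_sum1 : forall b, \sum_n nu b n = 1.
Hypothesis m_le : (m < N.+3)%N.

(** Two arities [m], two leaves off the spine, then 1/2 for equal gates times [1 / (2 * k)] for
    opposite literals. *)
Definition kill_prob b : R :=
  nu b (Ordinal m_le) ^+ 2 * nu false ord0 ^+ 2 / (4 * k)%N%:R.

Local Notation Ex := (Ex nu).
Local Notation wlab := (wlab nu).

Lemma sum_indic (T : finType) (a : T) (F : T -> R) :
  \sum_x F x * (x == a)%:R = F a.
Proof.
rewrite (bigD1 a) //= eqxx mulr1 big1 ?addr0 // => x /negbTE ->.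
by rewrite mulr0.
Qed.

Lemma sum_indic1 (T : finType) (a : T) : \sum_x (x == a)%:R = 1 :> R.
Proof.
by rewrite -[RHS](sum_indic a (fun=> 1)); apply: eq_bigr => x _; rewrite mul1r.
Qed.

Lemma sum_kill_lab b :
  \sum_(x : lab) wlab b x * (\sum_(x0 : lab) wlab b x0 * (\sum_(x01 : lab) wlab false x01 *
    (\sum_(x1 : lab) wlab false x1 * (kill_lab x x0 x1 x01)%:R))) = kill_prob b.
Proof.
have k4 : ((4 * k)%N%:R : R) != 0 by rewrite pnatr_eq0 muln_eq0 /= -lt0n.
have card_lit : \sum_(l : 'I_k * bool) (1 : R) = (2 * k)%N%:R.
  by rewrite sumr_const card_prod card_ord card_bool mulnC.
pose M := Ordinal m_le.
have arE (x : lab) (n : 'I_N.+3) : (ar x == n :> nat) = (x.1.1 == n) by [].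
(* [in1] to [in4] average over [x1], [x01], [x0] and [x] in this order, each time conditionally on
   the labels not yet averaged. *)
have in1 (x01 : lab) : \sum_(x1 : lab) wlab false x1 *
    ([&& ar x1 == 0%N, ar x01 == 0%N & x01.2 == (x1.2.1, ~~ x1.2.2)])%:R =
    (ar x01 == 0%N)%:R * (nu false ord0 * (2 / (4 * k)%N%:R)).
  transitivity ((ar x01 == 0%N)%:R * \sum_(x1 : lab) wlab false x1 *
    ((x1.1.1 == ord0)%:R * (fun=> 1) x1.1.2 * (x1.2 == (x01.2.1, ~~ x01.2.2))%:R)).
    rewrite mulr_sumr; apply: eq_bigr => x1 _.
    rewrite (arE x1 ord0) mulr1 mulrCA; congr (_ * _).
    have -> : (x01.2 == (x1.2.1, ~~ x1.2.2)) = (x1.2 == (x01.2.1, ~~ x01.2.2)).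
      case: x1 x01 => [? [i c]] [? [j d]] /=; rewrite !xpair_eqE [j == i]eq_sym.
      by case: c; case: d.
    by case: (x1.1.1 == ord0); case: (ar x01 == 0%N); rewrite ?mul1r ?mul0r ?mulr0.
  rewrite (sum_lab_prod nu false (fun n => (n == ord0)%:R) (fun=> 1)
    (fun l => (l == (x01.2.1, ~~ x01.2.2))%:R)).
  rewrite sum_indic sum_indic1 sumr_const card_bool mulr1.
  by congr (_ * _); rewrite mulrA.
have in2 : \sum_(x01 : lab) wlab false x01 * (ar x01 == 0%N)%:R = nu false ord0.
  rewrite -[RHS](sum_indic ord0 (nu false)).
  by rewrite -(sum_lab nu k_gt0 false (fun n => (n == ord0)%:R)).
have in3 c : \sum_(x0 : lab) wlab b x0 * ((ar x0 == m) && (c == conj_gate x0))%:R =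
    nu b M * ((2 * k)%N%:R / (4 * k)%N%:R).
  transitivity (\sum_(x : lab) wlab b x *
      ((x.1.1 == M)%:R * (x.1.2 == c)%:R * (fun=> 1) x.2)).
    apply: eq_bigr => x _; rewrite (arE x M) mulr1 [_ == conj_gate _]eq_sym.
    by congr (_ * _); case: (x.1.1 == M); rewrite ?mul1r ?mul0r.
  rewrite (sum_lab_prod nu b (fun n => (n == M)%:R) (fun d => (d == c)%:R) (fun=> 1)).
  by rewrite sum_indic sum_indic1 card_lit mulr1 mulrA.
have in4 : \sum_(x : lab) wlab b x * (ar x == m)%:R = nu b M.
  rewrite -[RHS](sum_indic M (nu b)).
  by rewrite -(sum_lab nu k_gt0 b (fun n => (n == M)%:R)).
pose c1 := nu false ord0 * (2 / (4 * k)%N%:R).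
transitivity (\sum_(x : lab) wlab b x * (ar x == m)%:R *
    (nu b M * ((2 * k)%N%:R / (4 * k)%N%:R) * (nu false ord0 * c1))).
  apply: eq_bigr => x _; rewrite -mulrA; congr (_ * _).
  rewrite -(in3 (conj_gate x)) -in2 mulr_suml mulr_sumr; apply: eq_bigr => x0 _.
  rewrite [RHS]mulrCA -[RHS]mulrA; congr (_ * _).
  rewrite mulrA -natrM mulnb mulr_suml mulr_sumr; apply: eq_bigr => x01 _.
  rewrite -[wlab _ _ * _ * c1]mulrA [RHS]mulrCA; congr (_ * _); rewrite -in1.
  rewrite mulr_sumr; apply: eq_bigr => x1 _; rewrite mulrCA; congr (_ * _).
  by rewrite -natrM mulnb [X in X && _]andbC.
rewrite -mulr_suml in4 /c1 /kill_prob -/M !natrM.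
have k0 : (k%:R : R) != 0 by rewrite pnatr_eq0 -lt0n.
by field.
Qed.

(** Killing reads only four labels, all outside the subtree two first-child steps down, hence is
    independent of that subtree. *)
Lemma Ex_kill b h (H : pat h.+1 -> R) :
  Ex b (fun s : pat h.+3 => (kill s)%:R * H (first_child (first_child s))) =
  kill_prob b * Ex b H.
Proof.
rewrite ExS -sum_kill_lab mulr_suml; apply: eq_bigr => x _; rewrite -mulrA.
congr (_ * _); rewrite ExS mulr_suml; apply: eq_bigr => x0 _; rewrite -mulrA.
congr (_ * _); rewrite -ExZ; apply: eq_Ex => s00.
rewrite mulrC.
transitivity (Ech nu (fun g0 => H s00 * (fun s01 : pat h.+1 => \sum_(x1 : lab) wlab false x1 *
   (kill_lab x x0 x1 s01.1)%:R) (g0 ord0))).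
  apply: eq_bigr => g0 _; congr (_ * _).
  rewrite -(ExS_lab k_gt0 nu_sum1 false h.+1
    (fun x1 => (kill_lab x x0 x1 (root_lab (g0 ord0)))%:R)).
  rewrite -ExZ -(Ech_at k_gt0 nu_sum1 ord0 (fun s => H s00 * _)).
  by apply: eq_bigr => g _; rewrite [X in _ * X]mulrC.
rewrite (Ech_at k_gt0 nu_sum1 ord0 (fun s01 : pat h.+1 => H s00 *
  \sum_(x1 : lab) wlab false x1 * (kill_lab x x0 x1 s01.1)%:R)) ExZ; congr (_ * _).
by rewrite (ExS_lab k_gt0 nu_sum1 false h
  (fun x01 => \sum_(x1 : lab) wlab false x1 * (kill_lab x x0 x1 x01)%:R)).
Qed.

End Complexity_bound.

(** * Exponential tail of the trimmed size along the spine *)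

Section Tail.
Variables (R : realType) (k N m : nat).
Local Notation pat := (pat k N).
Variable nu : bool -> 'I_N.+3 -> R.
Hypothesis k_gt0 : (0 < k)%N.
Hypothesis nu_ge0 : forall b n, 0 <= nu b n.
Hypothesis nu_sum1 : forall b, \sum_n nu b n = 1.
Hypothesis m_le : (m < N.+3)%N.
Hypothesis m_ge2 : (2 <= m)%N.
Variable theta : R.
Hypothesis theta_ge0 : 0 <= theta.

Local Notation Ex := (Ex nu).
Local Notation kp := (kill_prob k nu m_le).

Definition expZ h (s : pat h) : R := expR (theta * (trimmed_size m false s)%:R).
(** [trimmed_size] recurses two generations at a time; this is the exponential at the intermediate
    one, where killing is not tested. *)
Definition expZ1 h : pat h.+1 -> R := sub_val (@expZ h) (@expZ h) (expR theta).

Lemma expR_nat_ge1 (n : nat) : 1 <= expR (theta * n%:R).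
Proof. by rewrite -expR0 ler_expR mulr_ge0. Qed.

Lemma expZ_ge1 h (s : pat h) : 1 <= expZ s. Proof. exact: expR_nat_ge1. Qed.

Lemma sub_val_ge1 h (F0 F1 : pat h -> R) z s :
  (forall s, 1 <= F0 s) -> (forall s, 1 <= F1 s) -> 1 <= z -> 1 <= sub_val F0 F1 z s.
Proof.
move=> F01 F11 z1; rewrite /sub_val; case: ifP => // _.
apply: mulr_ege1 => //; elim/big_ind : _ => // x y; exact: mulr_ege1.
Qed.

Lemma expR_sum_children b h (phi : bool -> pat h -> nat) (s : pat h.+1) :
  expR (theta * (sum_children b phi s)%:R) =
  sub_val (fun s0 => expR (theta * (phi b s0)%:R))
    (fun s0 => expR (theta * (phi false s0)%:R)) (expR (theta * (~~ b)%:R)) s.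
Proof.
rewrite /sum_children /sub_val; case: ifP => // _.
rewrite natrD mulrDr expRD; congr (_ * _).
by rewrite natr_sum mulr_sumr expR_sum.
Qed.

Lemma eq_sub_val h (F0 F0' F1 F1' : pat h -> R) z s :
  F0 =1 F0' -> F1 =1 F1' -> sub_val F0 F1 z s = sub_val F0' F1' z s.
Proof.
by move=> E0 E1; rewrite /sub_val E0; case: ifP => // _; congr (_ * _); apply: eq_bigr.
Qed.

Lemma expR_sum_children2 h (s : pat h.+2) :
  expR (theta * (sum_children false (fun b' => sum_children b'
    (fun b'' => @trimmed_size _ _ m b'' h)) s)%:R)
  = sub_val (@expZ1 h) (@expZ1 h) (expR theta) s.
Proof.
by rewrite expR_sum_children /= mulr1; apply: eq_sub_val => s0;
  rewrite expR_sum_children mulr1.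
Qed.

(** All factors of the double product are at least 1, so it dominates any one of them. The gain from
    killing is thus bounded below through a subtree independent of [kill]. *)
Lemma sub_val_first_child h (s : pat h.+3) :
  kill m s -> expZ (first_child (first_child s)) <=
    sub_val (@expZ1 h.+1) (@expZ1 h.+1) (expR theta) s.
Proof.
have m0 : (m == 0%N) = false by case: m m_ge2.
have z1 : 1 <= expR theta by rewrite -expR0 ler_expR.
have e1 (s' : pat h.+1) : 1 <= expZ s' by exact: expZ_ge1.
have e2 (s' : pat h.+2) : 1 <= expZ1 s' by apply: sub_val_ge1.
have prod1 h' (F : pat h' -> R) (g : {ffun 'I_N.+1 -> pat h'}) n :
    (forall s, 1 <= F s) -> 1 <= \prod_(i < N.+1 | (i < n)%N) F (g i).
  move=> F1; elim/big_ind : _ => // x y; exact: mulr_ege1.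
move=> /andP[/and3P[/eqP armx /eqP armx0 _] _].
rewrite /sub_val -[s.1]/(root_lab s) armx m0.
rewrite -[X in X <= _]mulr1 ler_pM ?ler01 //.
- exact: le_trans ler01 (e1 _).
- rewrite /expZ1 /sub_val -[s.2.1.1]/(root_lab (first_child s)) armx0 m0.
  rewrite -[X in X <= _]mulr1 ler_pM ?ler01 //; first exact: le_trans ler01 (e1 _).
  exact: (prod1 h.+1 (@expZ h.+1) s.2.1.2.2 m.-1 e1).
- exact: (prod1 h.+2 (@expZ1 h.+1) s.2.2 m.-1 e2).
Qed.

(** Without killing, two generations compose the generating function with itself. On [kill] the
    exponential drops to 1 from at least its value two first children down, and independence turns
    this drop into the subtracted term. *)
Lemma mgf_step h :
  Ex false (@expZ h.+3) <=
    gen_fun nu false (expR theta)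
      (gen_fun nu false (expR theta) (Ex false (@expZ h.+1)) (Ex false (@expZ h.+1)))
      (gen_fun nu false (expR theta) (Ex false (@expZ h.+1)) (Ex false (@expZ h.+1)))
    - kp false * (Ex false (@expZ h.+1) - 1).
Proof.
rewrite -(Ex_sub_val k_gt0 nu_sum1 false (@expZ h.+1)) -/(@expZ1 h.+1).
rewrite -(Ex_sub_val k_gt0 nu_sum1 false (@expZ1 h.+1)).
rewrite -(Ex_cst k_gt0 nu_sum1 false h.+1 1) -ExB -Ex_kill // -ExB.
apply: le_Ex => // s; rewrite {1}/expZ [trimmed_size _ _ s]/=.
rewrite -[kill_lab _ _ _ _ _]/(kill m s).
case ks: (kill m s).
  have := sub_val_first_child ks; rewrite mulr0 expR0 mul1r; lra.
by rewrite expR_sum_children2 mul0r subr0.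
Qed.

Lemma mgf_le (delta : R) : 0 <= delta -> expR theta <= 1 + delta ->
  (forall G, 1 <= G <= 1 + delta ->
    gen_fun nu false (expR theta) (gen_fun nu false (expR theta) G G)
      (gen_fun nu false (expR theta) G G) - kp false * (G - 1) <= 1 + delta) ->
  forall j, 1 <= Ex false (@expZ j.*2.+1) <= 1 + delta.
Proof.
move=> d0 td Hstep j.
have ge1 h : 1 <= Ex false (@expZ h).
  rewrite -(Ex_cst k_gt0 nu_sum1 false h 1); apply: le_Ex => // s; exact: expZ_ge1.
rewrite ge1 /=; elim: j => [|j IH]; last first.
  by rewrite doubleS; apply: le_trans (mgf_step _) (Hstep _ _); rewrite ge1.
by rewrite /expZ /= mulr1 Ex_cst.
Qed.

(* Contribution to [trimmed_size true s] of the subtrees hanging off the spine. *)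
Definition side_size h (s : pat h.+2) : nat :=
  if ar s.1 == 0%N then 0%N else
  ((if ar s.2.1.1 == 0%N then 0 else
     \sum_(i < N.+1 | (i < (ar s.2.1.1).-1)%N) trimmed_size m false (s.2.1.2.2 i)) +
   \sum_(i < N.+1 | (i < (ar s.1).-1)%N)
     sum_children false (fun b => @trimmed_size _ _ m b h) (s.2.2 i))%N.

Lemma expR_side_size h (s : pat h.+2) : expR (theta * (side_size s)%:R) =
  sub_val (sub_val (fun=> 1) (@expZ h) 1) (@expZ1 h) 1 s.
Proof.
rewrite /side_size /sub_val; case: ifP => [_|_]; first by rewrite mulr0 expR0.
rewrite natrD mulrDr expRD; congr (_ * _).
  case: ifP => _; first by rewrite mulr0 expR0.
  by rewrite natr_sum mulr_sumr expR_sum mul1r.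
rewrite natr_sum mulr_sumr expR_sum; apply: eq_bigr => i _.
by rewrite expR_sum_children mulr1.
Qed.

(** Induction along the spine. Without killing, the size is at most [side_size] plus the size two
    spine steps further, so given the side trees the tail is at most
    [expR (- theta * (n - side_size))]. By the second hypothesis the side trees cost a factor at
    most 1 once killed patterns are removed. *)
Lemma spine_tail (delta : R) :
  (forall j, 1 <= Ex false (@expZ j.*2.+1) <= 1 + delta) ->
  (forall G, 1 <= G <= 1 + delta ->
    gen_fun nu true 1 (gen_fun nu true 1 1 G) (gen_fun nu false (expR theta) G G)
      - kp true <= 1) ->
  forall j n, Ex true (fun s : pat j.*2.+1 => (n <= trimmed_size m true s)%N%:R)
    <= expR (- theta * n%:R).
Proof.
move=> HG Hstep j n.
case: n => [|n].
  by rewrite mulr0 expR0 (@eq_Ex _ _ _ nu true _ _ (fun=> 1)) ?Ex_cst.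
elim: j n => [|j IH] n.
  rewrite (@eq_Ex _ _ _ nu true _ _ (fun=> 0)) ?Ex_cst //; exact: expR_ge0.
rewrite doubleS; set h := j.*2.
have IH' n' : Ex true (fun s : pat h.+1 => (n' <= trimmed_size m true s)%N%:R)
    <= expR (- theta * n'%:R).
  case: n' => [|n' //].
  by rewrite mulr0 expR0 (@eq_Ex _ _ _ nu true _ _ (fun=> 1)) ?Ex_cst.
pose F (s : pat h.+3) : R := (~~ kill m s)%:R *
  (n.+1 - side_size s <= trimmed_size m true (first_child (first_child s)))%N%:R.
pose F' (s : pat h.+3) : R := expR (- theta * n.+1%:R) *
  ((~~ kill m s)%:R * expR (theta * (side_size s)%:R)).
apply: (@le_trans _ _ (Ex true F)).
  apply: le_Ex => // s; rewrite /F [trimmed_size _ _ s]/=.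
  rewrite -[kill_lab _ _ _ _ _]/(kill m s); case: (kill m s) => /=.
    by rewrite mul0r.
  have leb (a b : bool) : (a -> b) -> (a <= b)%N by case: a; case: b => // /(_ isT).
  rewrite mul1r ler_nat leq_subLR; apply: leb => /leq_trans; apply.
  rewrite /side_size /sum_children /=; case: ifP => //= _; case: ifP => /= _.
    by rewrite !add0n leq_addr.
  by rewrite -addnA addnC -addnA.
apply: (@le_trans _ _ (Ex true F')).
  apply: le_ExS => // x g; apply: le_ExS => // x0 g0.
  pose s s00 : pat h.+3 := (x, ((x0, (s00, g0)), g)).
  have ksE s00 s00' : kill m (s s00) = kill m (s s00') by [].
  have xsE s00 s00' : side_size (s s00) = side_size (s s00') by [].
  (* [a] is an arbitrary filler: [kill] and [side_size] do not see the subtree it stands for. *)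
  have [a _] : exists a : pat h.+1, True.
    by exists (g0 ord0).
  rewrite (@eq_Ex _ _ _ nu true _ _ (fun s00 => (~~ kill m (s a))%:R *
    (n.+1 - side_size (s a) <= trimmed_size m true s00)%N%:R)) // ExZ.
  rewrite [leRHS](@eq_Ex _ _ _ nu true _ _ (fun=> F' (s a))) // Ex_cst // /F'.
  rewrite mulrCA; apply: ler_wpM2l => //; apply: le_trans (IH' _) _.
  rewrite -expRD ler_expR !mulNr addrC -mulrBr -mulrN ler_wpM2l //.
  rewrite lerNl opprB lerBlDr -natrD ler_nat; lia.
rewrite ExZ -[leRHS]mulr1 ler_wpM2l ?expR_ge0 //.
apply: le_trans (Hstep (Ex false (@expZ h.+1)) (HG j)).
rewrite -(Ex_sub_val k_gt0 nu_sum1 false (@expZ h.+1)) -/(@expZ1 h.+1).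
have -> : gen_fun nu true 1 1 (Ex false (@expZ h.+1)) =
    Ex true (sub_val (fun=> 1) (@expZ h.+1) 1) by rewrite Ex_sub_val // Ex_cst.
rewrite -(Ex_sub_val k_gt0 nu_sum1 true (sub_val (fun=> 1) (@expZ h.+1) 1)).
have -> : kp true = Ex true (fun s : pat h.+3 => (kill m s)%:R * 1).
  by rewrite (Ex_kill k_gt0 nu_sum1 m_le true (fun=> 1)) Ex_cst ?mulr1.
(* Off [kill] this is an equality; on [kill] it says that the exponential of the side size is at
   least 1. *)
rewrite -ExB; apply: le_Ex => // s; rewrite -expR_side_size mulr1.
have := expR_nat_ge1 (side_size s); case: (kill m s); rewrite /= ?mul0r ?mul1r ?subr0 //.
by rewrite subr_ge0.
Qed.

End Tail.

(** * Offspring estimates and choice of the constants *)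

Section Offspring_estimates.
Variable R : realType.

Lemma expR_le_inv (y : R) : y < 1 -> expR y <= (1 - y)^-1.
Proof.
move=> y1; rewrite -[expR y]invrK lef_pV2 ?posrE ?invr_gt0 ?expR_gt0 ?subr_gt0 //.
by rewrite -expRN; apply: expR_ge1Dx.
Qed.

Lemma expR_le12 (y : R) : 0 <= y <= 2^-1 -> expR y <= 1 + 2 * y.
Proof.
move=> /andP[y0 y1]; apply: le_trans (expR_le_inv _) _; first by lra.
rewrite -[_^-1]mul1r ler_pdivrMr; nra.
Qed.

Lemma expR_le_lin (y : R) : expR y <= 1 + y * expR y.
Proof.
have := expR_ge1Dx (- y); rewrite expRN => H.
have e0 := expR_gt0 y; have : (1 - y) * expR y <= 1; last by nra.
by rewrite -ler_pdivlMr // div1r.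
Qed.

Lemma expR_le_quad (y : R) : 0 <= y -> expR y <= 1 + y + y ^+ 2 * expR y.
Proof. by move=> y0; have := expR_le_lin y; nra. Qed.

(** The factor is the inverse square of [a / 4]: the square of [a / 4 * n] is absorbed by half of
    the exponent. *)
Lemma sqr_le_expR (a : R) n : 0 < a ->
  n%:R ^+ 2 * expR (a / 2 * n%:R) <= 16 / a ^+ 2 * expR (a * n%:R).
Proof.
move=> a0; have n0 : 0 <= n%:R :> R by [].
set e := expR (a / 2 * n%:R).
have -> : expR (a * n%:R) = e * e by rewrite -expRD; congr expR; lra.
rewrite mulrA ler_wpM2r ?expR_ge0 //.
have e1 : 1 + a / 4 * n%:R <= expR (a / 4 * n%:R) by exact: expR_ge1Dx.
have eE : e = expR (a / 4 * n%:R) ^+ 2 by rewrite expr2 -expRD; congr expR; lra.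
have : (a / 4 * n%:R) ^+ 2 <= e; last first.
  move=> H; rewrite mulrAC ler_pdivlMr ?exprn_gt0 //; nra.
have a4 : 0 <= a / 4 * n%:R by apply: mulr_ge0 => //; lra.
by rewrite eE ler_pXn2r ?nnegrE ?expR_ge0 //; lra.
Qed.

(** Expansions at [d = 0], starting from [(1 + d) ^+ n <= expR (n * d)]; since [d <= a / 2], the
    remainder, quadratic in [n], is paid by the exponential at [a]. *)
Lemma expr1D_le (a d : R) n : 0 < a -> 0 <= d <= a / 2 ->
  (1 + d) ^+ n <= 1 + n%:R * d + d ^+ 2 * (16 / a ^+ 2) * expR (a * n%:R) /\
  n%:R * (1 + d) ^+ n.-1 <= n%:R + d * (16 / a ^+ 2) * expR (a * n%:R).
Proof.
move=> a0 /andP[d0 da]; have n0 : 0 <= n%:R :> R by [].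
have sqn := sqr_le_expR n a0; set E := expR (a * n%:R) in sqn *.
have d1E : (1 + d) ^+ n <= expR (n%:R * d).
  by rewrite mulrC expRM_natr lerXn2r ?nnegrE ?expR_ge0 ?addr_ge0 // expR_ge1Dx.
have ee : expR (n%:R * d) <= expR (a / 2 * n%:R).
  by rewrite ler_expR mulrC ler_wpM2r.
have nd : n%:R ^+ 2 * expR (n%:R * d) <= 16 / a ^+ 2 * E.
  by apply: le_trans sqn; rewrite ler_wpM2l // exprn_ge0.
split.
  apply: le_trans d1E (le_trans (expR_le_quad _) _); first by rewrite mulr_ge0.
  rewrite lerD2l (_ : (n%:R * d) ^+ 2 * _ = d ^+ 2 * (n%:R ^+ 2 * expR (n%:R * d))).
    by rewrite -mulrA ler_wpM2l ?sqr_ge0.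
  by ring.
apply: (@le_trans _ _ (n%:R * (1 + n%:R * d * expR (n%:R * d)))).
  rewrite ler_wpM2l //; apply: le_trans (expR_le_lin _).
  apply: le_trans d1E; case: n {n0 sqn E ee nd} => // n.
  by rewrite exprS ler_peMl ?exprn_ge0 ?addr_ge0 // lerDl.
have := ler_wpM2l d0 nd; rewrite expr2; nra.
Qed.

Lemma ler_subXn (x y : R) n : 1 <= x -> x <= y -> y - x <= y ^+ n.+1 - x ^+ n.+1.
Proof.
move=> x1 xy; elim: n => [|n IH] //.
have xn : 1 <= x ^+ n.+1 by rewrite exprn_ege1.
by rewrite exprS [x ^+ n.+2]exprS; nra.
Qed.

Section Constants.
Variables (mu : nat -> R) (a B : R) (m : nat).
Hypothesis mu_ge0 : forall n, 0 <= mu n.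
Hypothesis mu_sum : forall M, \sum_(n < M) mu n <= 1.
Hypothesis mu_mean : forall M, \sum_(n < M) n%:R * mu n <= 1.
Hypothesis a_gt0 : 0 < a.
Hypothesis mu_exp : forall M, \sum_(n < M) mu n * expR (a * n%:R) <= B.
Hypothesis mu0_gt0 : 0 < mu 0%N.
Hypothesis mum_gt0 : 0 < mu m.
Hypothesis m_ge2 : (2 <= m)%N.

(* Law of the number of children, with the mass above the cap N + 2 moved
   to 0. *)
Definition offspring (b : bool) (n : nat) : R := if b then n%:R * mu n else mu n.
Definition capped N (b : bool) (n : 'I_N.+3) : R :=
  if n == ord0 then 1 - \sum_(i < N.+3 | i != ord0) offspring b i
  else offspring b n.

Lemma offspring_ge0 b n : 0 <= offspring b n.
Proof. by rewrite /offspring; case: b => //; rewrite mulr_ge0. Qed.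

Lemma sum_offspring N b : \sum_(i < N.+3 | i != ord0) offspring b i <= 1.
Proof.
apply: (@le_trans _ _ (\sum_(i < N.+3) offspring b i)).
  by rewrite [leRHS](bigD1 ord0) //= lerDr offspring_ge0.
by case: b; [apply: mu_mean|apply: mu_sum].
Qed.

Lemma capped_ge0 N b n : 0 <= @capped N b n.
Proof.
rewrite /capped; case: ifP => _; last exact: offspring_ge0.
by rewrite subr_ge0 sum_offspring.
Qed.

Lemma capped_sum1 N b : \sum_n @capped N b n = 1.
Proof.
rewrite (bigD1 ord0) //= {1}/capped eqxx.
rewrite (eq_bigr (fun i : 'I_N.+3 => offspring b i)) ?subrK // => i /negbTE i0.
by rewrite /capped i0.
Qed.

Lemma capped0_ge N : mu 0%N <= @capped N false ord0.
Proof.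
rewrite /capped eqxx lerBrDr; apply: le_trans (mu_sum N.+3).
by rewrite [leRHS](bigD1 ord0).
Qed.

Lemma capped_le1 N b n : @capped N b n <= 1.
Proof.
rewrite -(capped_sum1 N b) (bigD1 n) //= lerDl sumr_ge0 // => i _.
exact: capped_ge0.
Qed.

Lemma capped_m N b (m_le : (m < N.+3)%N) : mu m <= capped b (Ordinal m_le).
Proof.
rewrite /capped -[_ == ord0]/(m == 0%N); case: eqP => [m0|_].
  by move: m_ge2; rewrite m0.
rewrite /offspring /=; case: b => //; rewrite ler_peMl // ler1n; lia.
Qed.

(** [C] is the coefficient of the remainders in the generating functions; [q / k] is a lower bound
    for the killing probabilities. *)
Let C := 16 / a ^+ 2 * B.
Let q := mu m ^+ 2 * mu 0%N ^+ 2 / 4.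

Lemma C_ge0 : 0 <= C.
Proof.
rewrite mulr_ge0 // ?divr_ge0 ?sqr_ge0 //.
by apply: le_trans (mu_exp 0); rewrite big_ord0.
Qed.

Lemma sum_capped_exp N :
  \sum_(n < N.+3 | n != ord0) mu n * expR (a * n%:R) <= B.
Proof.
apply: le_trans (mu_exp N.+3); rewrite [leRHS](bigD1 ord0) //= lerDr.
by rewrite mulr_ge0 ?expR_ge0.
Qed.

Lemma sum_capped_mean N : \sum_(n < N.+3 | n != ord0) n%:R * mu n <= 1.
Proof. exact: (sum_offspring N true). Qed.

(** Criticality: the coefficient of [d] is a mean, at most 1, and the exponential moment bounds the
    rest. *)
Lemma gen_false_le N (z theta d : R) : 0 <= theta -> z <= 1 + 2 * theta ->
  0 <= d <= a / 2 ->
  gen_fun (@capped N) false z (1 + d) (1 + d) <= 1 + 2 * theta + d + C * d ^+ 2.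
Proof.
move=> t0 zt dd; have d0 : 0 <= d by case/andP: dd.
have nu0 := capped_ge0 false (ord0 : 'I_N.+3).
have nu1 := capped_le1 false (ord0 : 'I_N.+3).
have := capped_sum1 N false; rewrite (bigD1 ord0) //=.
have cE (n : 'I_N.+3) : n != ord0 -> capped false n = mu n.
  by rewrite /capped => /negbTE ->.
rewrite /gen_fun (eq_bigr (fun n : 'I_N.+3 => mu n)); last by move=> n /cE.
set s1 := bigop.body _ _ _ => s1E; set s2 := bigop.body _ _ _.
have s2le : s2 <= s1 + d * (\sum_(n < N.+3 | n != ord0) n%:R * mu n)
    + d ^+ 2 * (16 / a ^+ 2) * (\sum_(n < N.+3 | n != ord0) mu n * expR (a * n%:R)).
  rewrite /s1 /s2 !mulr_sumr -!big_split; apply: ler_sum => n n0 /=.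
  rewrite cE // -exprS prednK; last by rewrite lt0n; exact: n0.
  have [+ _] := expr1D_le n a_gt0 dd.
  by move=> /(ler_wpM2l (mu_ge0 n)) /le_trans; apply; nra.
have b1 := sum_capped_mean N.
have b2 : d ^+ 2 * (16 / a ^+ 2) * (\sum_(n < N.+3 | n != ord0) mu n * expR (a * n%:R))
    <= C * d ^+ 2.
  rewrite -mulrA [C * _]mulrC ler_wpM2l ?sqr_ge0 // ler_wpM2l ?sum_capped_exp //.
  by rewrite divr_ge0 ?sqr_ge0.
nra.
Qed.

(** Size-biasing brings a factor [n], so the side trees cost a factor [1 + C * d], already of first
    order in [d]. *)
Lemma gen_true_le N (d x0 x1 : R) : 0 <= d <= a / 2 -> 1 <= x0 -> 0 <= x1 <= 1 + d ->
  gen_fun (@capped N) true 1 x0 x1 <= x0 * (1 + C * d).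
Proof.
move=> dd x01 /andP[x10 x1d]; have d0 : 0 <= d by case/andP: dd.
have nu0 := capped_ge0 true (ord0 : 'I_N.+3).
have := capped_sum1 N true; rewrite (bigD1 ord0) //=.
have cE (n : 'I_N.+3) : n != ord0 -> capped true n = n%:R * mu n.
  by rewrite /capped => /negbTE ->.
rewrite /gen_fun (eq_bigr (fun n : 'I_N.+3 => n%:R * mu n)); last by move=> n /cE.
set s1 := bigop.body _ _ _ => s1E; set s2 := bigop.body _ _ _.
have s2le : s2 <= x0 * (s1 +
    d * (16 / a ^+ 2) * (\sum_(n < N.+3 | n != ord0) mu n * expR (a * n%:R))).
  rewrite /s1 /s2 !mulr_sumr -!big_split mulr_sumr; apply: ler_sum => n n0 /=.
  rewrite cE // mulrCA ler_wpM2l ?(le_trans ler01) //.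
  apply: (@le_trans _ _ (mu n * (n%:R * (1 + d) ^+ n.-1))).
    rewrite mulrCA mulrA ler_wpM2l ?mulr_ge0 //.
    by rewrite lerXn2r ?nnegrE // (le_trans x10).
  have [_ +] := expr1D_le n a_gt0 dd.
  by move=> /(ler_wpM2l (mu_ge0 n)) /le_trans; apply; nra.
have b2 : d * (16 / a ^+ 2) * (\sum_(n < N.+3 | n != ord0) mu n * expR (a * n%:R))
    <= C * d.
  rewrite -mulrA [C * _]mulrC ler_wpM2l // ler_wpM2l ?sum_capped_exp //.
  by rewrite divr_ge0 ?sqr_ge0.
nra.
Qed.

(** The term of arity [m] alone has slope at least [mu m] beyond 1, and the other terms are
    nondecreasing. *)
Lemma gen_false_mono N (z x y : R) (m_le : (m < N.+3)%N) : 1 <= x -> x <= y ->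
  mu m * (y - x) <= gen_fun (@capped N) false z y y - gen_fun (@capped N) false z x x.
Proof.
move=> x1 xy; rewrite /gen_fun opprD addrACA subrr add0r -sumrB.
have mono (n : 'I_N.+3) : n != ord0 ->
    capped false n * (y - x) <= capped false n * (y * y ^+ n.-1)
      - capped false n * (x * x ^+ n.-1).
  move=> n0; rewrite -mulrBr ler_wpM2l ?capped_ge0 // -!exprS.
  exact: ler_subXn.
have m0 : Ordinal m_le != ord0 by rewrite -(inj_eq val_inj) /=; lia.
rewrite (bigD1 (Ordinal m_le)) //=.
apply: le_trans (_ : capped false (Ordinal m_le) * (y - x) <= _).
  by rewrite ler_wpM2r ?subr_ge0 ?capped_m.
apply: le_trans (mono _ m0) _; rewrite lerDl sumr_ge0 // => n /andP[n0 _].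
by apply: le_trans (mono n n0); rewrite mulr_ge0 ?capped_ge0 ?subr_ge0.
Qed.

Lemma gen_false_ge1 N (z x : R) : 1 <= z -> 1 <= x -> 1 <= gen_fun (@capped N) false z x x.
Proof.
move=> z1 x1; rewrite -(capped_sum1 N false) (bigD1 ord0) //= /gen_fun lerD //.
  by rewrite ler_peMr ?capped_ge0.
apply: ler_sum => n _; rewrite ler_peMr ?capped_ge0 // -exprS exprn_ege1 //.
Qed.

(** The lower bound is the gain set against the error terms. The upper bound is the square of the
    slope in [gen_false_mono], so that two generations minus killing stay nondecreasing. *)
Lemma kill_prob_bounds N k b (m_le : (m < N.+3)%N) : (0 < k)%N ->
  q / k%:R <= kill_prob k (@capped N) m_le b /\
  kill_prob k (@capped N) m_le false <= mu m ^+ 2.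
Proof.
move=> k0; have k0' : 0 < k%:R :> R by rewrite ltr0n.
have k1 : 1 <= k%:R :> R by rewrite ler1n.
have c0 := capped_ge0; split.
  rewrite /kill_prob /q natrM invfM -mulrA ler_wpM2r //.
  by rewrite ler_pM ?sqr_ge0 // ler_pXn2r ?nnegrE ?capped0_ge ?capped_m.
have cm : capped false (Ordinal m_le) = mu m.
  rewrite /capped -[_ == ord0]/(m == 0%N); case: eqP => // m0.
  by move: m_ge2; rewrite m0.
rewrite /kill_prob cm natrM ler_pdivrMr; last by rewrite mulr_gt0.
rewrite ler_wpM2l ?sqr_ge0 //; have := capped_le1 false (ord0 : 'I_N.+3).
have := c0 N false ord0; nra.
Qed.

Lemma tail_bound : exists2 c2 : R, 0 < c2 &
  forall k N (m_le : (m < N.+3)%N) j n, (0 < k)%N ->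
    Ex (@capped N) true (fun s : pat k N j.*2.+1 => (n <= trimmed_size m true s)%N%:R)
      <= expR (- c2 * n%:R / k%:R ^+ 2).
Proof.
have C0 := C_ge0.
have q0 : 0 < q by rewrite /q !mulr_gt0 ?exprn_gt0.
(* One generation takes [1 + d] to at most [1 + D * d]; [M] dominates the coefficients of all errors
   over two generations, on the spine and off it. *)
pose D := C + 3; pose M := C + 4 + C * D ^+ 2 + 2 * C * D + C ^+ 2 * D ^+ 2.
have D0 : 0 < D by rewrite /D; lra.
have M0 : 0 < M.
  rewrite /M; have := mulr_ge0 C0 (sqr_ge0 D); have := mulr_ge0 (sqr_ge0 C) (sqr_ge0 D).
  have := mulr_ge0 C0 (ltW D0); nra.
(* With [d = eta / k], the three bounds give [2 * d ^+ 2 <= d], [D * d <= a / 2] and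
   [M * d <= q / k]. *)
pose eta := Num.min (2^-1) (Num.min (a / (2 * D)) (q / M)).
have eta0 : 0 < eta.
  have e2 : 0 < a / (2 * D) by rewrite divr_gt0 // mulr_gt0.
  have e3 : 0 < q / M by rewrite divr_gt0.
  by rewrite /eta !lt_min e2 e3 invr_gt0 ltr0n.
have [eta1 [eta2 eta3]] : eta <= 2^-1 /\ eta <= a / (2 * D) /\ eta <= q / M.
  by rewrite /eta !ge_min !lexx ?orbT.
exists (eta ^+ 2); first by rewrite exprn_gt0.
move=> k N m_le j n k0.
have k0' : 0 < k%:R :> R by rewrite ltr0n.
have k1 : 1 <= k%:R :> R by rewrite ler1n.
(* A killing probability of order [1 / k] acting on an excess [d] gains only the order of [d ^+ 2],
   which limits [theta]. *)
pose d := eta / k%:R; pose theta := d ^+ 2.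
have d0 : 0 < d by rewrite divr_gt0.
have deta : d <= eta by rewrite ler_pdivrMr // ler_peMr // ltW.
have t0 : 0 <= theta by rewrite sqr_ge0.
have td : theta <= d / 2 by rewrite /theta; nra.
have z2 : expR theta <= 1 + 2 * theta by apply: expR_le12; rewrite t0 /=; nra.
have z1 : 1 <= expR theta by rewrite -expR0 ler_expR.
have Dd : D * d <= a / 2.
  apply: (@le_trans _ _ (D * (a / (2 * D)))).
    by rewrite ler_wpM2l ?(ltW D0) // (le_trans deta).
  by rewrite invfM mulrCA [D * _]mulrCA mulfV ?mulr1 // gt_eqF.
have D1 : 1 <= D by rewrite /D; lra.
have da : 0 <= d <= a / 2 by rewrite ltW //=; apply: le_trans Dd; nra.
have Mq : M * d <= q / k%:R.
  by rewrite /d mulrA ler_pM2r ?invr_gt0 // mulrC -ler_pdivlMr.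
have [kt _] := kill_prob_bounds true m_le k0.
have [kf kf'] := kill_prob_bounds false m_le k0.
set G1 := gen_fun (@capped N) false (expR theta).
have G1d : G1 (1 + d) (1 + d) <= 1 + D * d.
  apply: le_trans (gen_false_le N t0 z2 da) _.
  have dd1 : d ^+ 2 <= d by rewrite expr2 ler_piMr ?ltW //; lra.
  have := ler_wpM2l C0 dd1; rewrite /D; lra.
have tE : - eta ^+ 2 * n%:R / k%:R ^+ 2 = - theta * n%:R.
  by rewrite /theta /d exprMn exprVn; ring.
rewrite tE.
apply: (spine_tail (m_le := m_le) k0 (@capped_ge0 N) (@capped_sum1 N) m_ge2 t0 (delta := d)).
  apply: (mgf_le (m_le := m_le) k0 (@capped_ge0 N) (@capped_sum1 N) m_ge2 t0 (ltW d0)) => //.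
    by lra.
  move=> G /andP[Gge Gle].
  (* The map is nondecreasing in [G], so it is enough to treat [G = 1 + d]. *)
  apply: (@le_trans _ _ (G1 (G1 (1 + d) (1 + d)) (G1 (1 + d) (1 + d))
      - kill_prob k (@capped N) m_le false * d)).
    have s1 := gen_false_mono (expR theta) m_le Gge Gle.
    have GG1 := gen_false_ge1 N z1 Gge.
    have s0 : G1 G G <= G1 (1 + d) (1 + d).
      by rewrite -subr_ge0; apply: le_trans s1; rewrite mulr_ge0 ?subr_ge0.
    have s2 := gen_false_mono (expR theta) m_le GG1 s0.
    rewrite -/G1 in s1 s2 *.
    have s3 : mu m * (mu m * (1 + d - G)) <= mu m * (G1 (1 + d) (1 + d) - G1 G G).
      by rewrite ler_wpM2l.
    have s4 : kill_prob k (@capped N) m_le false * (1 + d - G) <= mu m ^+ 2 * (1 + d - G).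
      by rewrite ler_wpM2r ?subr_ge0.
    have := mu_ge0 m; lra.
  pose d1 := G1 (1 + d) (1 + d) - 1.
  have d1E : G1 (1 + d) (1 + d) = 1 + d1 by rewrite /d1; ring.
  have d10 : 0 <= d1 by rewrite subr_ge0 gen_false_ge1 // lerDl ltW.
  have d1a : 0 <= d1 <= a / 2 by rewrite d10 /=; lra.
  rewrite d1E; have := gen_false_le N t0 z2 d1a; rewrite -/G1 => H1.
  have := gen_false_le N t0 z2 da; rewrite -/G1 d1E => H2.
  have d1D : d1 ^+ 2 <= D ^+ 2 * d ^+ 2.
    have Dd0 : 0 <= D * d by rewrite mulr_ge0 ?ltW.
    by rewrite -exprMn lerXn2r ?nnegrE //; move: G1d; rewrite d1E lerD2l.
  have H3 : C * d1 ^+ 2 <= C * (D ^+ 2 * d ^+ 2) by rewrite ler_wpM2l.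
  (* Two generations add to [1 + d] at most this coefficient times [d ^+ 2], and killing removes as
     much. *)
  have H4 : (C + 4 + C * D ^+ 2) * d <= kill_prob k (@capped N) m_le false.
    apply: le_trans kf; apply: le_trans Mq; rewrite ler_wpM2r ?(ltW d0) // /M.
    have := mulr_ge0 C0 (ltW D0); have := mulr_ge0 (sqr_ge0 C) (sqr_ge0 D); nra.
  have H5 := ler_wpM2r (ltW d0) H4.
  rewrite /theta in H1 H2; lra.
move=> G /andP[Gge Gle].
have Gd : 0 <= G <= 1 + d by rewrite (le_trans ler01).
have I0 := gen_true_le N da (lexx 1) Gd.
have I1 : 1 <= gen_fun (@capped N) true 1 1 G.
  apply: (@le_trans _ _ (\sum_n @capped N true n)); first by rewrite capped_sum1.
  rewrite (bigD1 ord0) //= /gen_fun lerD ?mulr1 //.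
  by apply: ler_sum => i _; rewrite ler_peMr ?capped_ge0 // mul1r exprn_ege1.
have GG1 := gen_false_ge1 N z1 Gge; rewrite -/G1 in GG1 *.
have s0 : G1 G G <= 1 + D * d.
  apply: le_trans G1d; rewrite -subr_ge0.
  by apply: le_trans (gen_false_mono _ m_le Gge Gle); rewrite mulr_ge0 ?subr_ge0.
have Dd' : 0 <= D * d <= a / 2 by rewrite Dd mulr_ge0 ?ltW.
have GD : 0 <= G1 G G <= 1 + D * d by rewrite (le_trans ler01).
have I2 := gen_true_le N Dd' I1 GD.
rewrite lerBlDr; apply: le_trans I2 _; rewrite mul1r in I0.
have CDd : 0 <= C * (D * d) by rewrite mulr_ge0 // mulr_ge0 // ltW.
apply: (@le_trans _ _ ((1 + C * d) * (1 + C * (D * d)))).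
  by rewrite ler_wpM2r // addr_ge0.
(* On the spine the product of the two factors exceeds 1 by a multiple of [d], which the killing
   probability itself dominates. *)
have H5 : (2 * C * D + C ^+ 2 * D ^+ 2) * d <= kill_prob k (@capped N) m_le true.
  apply: le_trans kt; apply: le_trans Mq; rewrite ler_wpM2r ?(ltW d0) // /M.
  have := mulr_ge0 C0 (sqr_ge0 D); nra.
have H6 : C * d <= C * (D * d) by rewrite ler_wpM2l //; nra.
have d1 : d <= 1 by lra.
have H7 : (C * (D * d)) * (C * (D * d)) <= C ^+ 2 * D ^+ 2 * d.
  have -> : C * (D * d) * (C * (D * d)) = C ^+ 2 * D ^+ 2 * d * d by ring.
  rewrite ler_piMr // mulr_ge0 ?(ltW d0) //.
  by apply: mulr_ge0; apply: sqr_ge0.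
nra.
Qed.

End Constants.
End Offspring_estimates.

(** * Permutations of the variables *)

Section Symmetry.
Variable k : nat.
Implicit Types (f : boolfun k) (sg : {perm 'I_k}).

Definition relabel_fun sg f : boolfun k := 
  [ffun x : {ffun 'I_k -> bool} => f [ffun i => x (sg i)]].

Fixpoint relabel_tree sg (t : aotree k) : aotree k :=
  match t with
  | Leaf l => Leaf (sg l.1, l.2)
  | Node c t1 t2 ts =>
      Node c (relabel_tree sg t1) (relabel_tree sg t2) (map (relabel_tree sg) ts)
  end.

Lemma leaves_relabel sg t : leaves (relabel_tree sg t) = leaves t.
Proof.
elim/aotree_nested_ind: t => // c t1 t2 ts IH /=.
rewrite (IH 0%N isT) (IH 1%N isT); congr (_ + _)%N.
have {}IH i : (i < size ts)%N -> leaves (relabel_tree sg (nth t1 ts i)) = leaves (nth t1 ts i).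
  by move=> Hi; apply: (IH i.+2).
elim: ts IH => //= t ts IHts IH; rewrite (IH 0%N isT) IHts // => i Hi.
exact: (IH i.+1).
Qed.

Lemma eval_relabel sg t x :
  eval x (relabel_tree sg t) = eval [ffun i => x (sg i)] t.
Proof.
elim/aotree_nested_ind: t => [l|c t1 t2 ts IH]; first by rewrite /= ffunE.
rewrite [relabel_tree _ _]/= !eval_Node; congr gate_eval => /=.
rewrite (IH 0%N isT) (IH 1%N isT); congr [:: _, _ & _]; rewrite -map_comp.
apply: (@eq_from_nth _ false) => [|i]; rewrite !size_map // => Hi.
by rewrite !(nth_map t1) //=; apply: (IH i.+2).
Qed.

Lemma fun_of_tree_relabel sg t :
  fun_of_tree (relabel_tree sg t) = relabel_fun sg (fun_of_tree t).
Proof. by apply/ffunP => x; rewrite !ffunE eval_relabel. Qed.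

Lemma relabel_funK sg : cancel (relabel_fun sg) (relabel_fun sg^-1%g).
Proof.
move=> f; apply/ffunP => x; rewrite !ffunE; congr (f _).
by apply/ffunP => i; rewrite !ffunE permK.
Qed.

Lemma complexity_relabel_le (i0 : 'I_k) sg f :
  (complexity (relabel_fun sg f) <= complexity f)%N.
Proof.
have [[b fb]|fnc] := pselect (constant_fun f).
  by rewrite complexity_const //; exists b => x; rewrite ffunE fb.
have [t tf] := fun_of_tree_surj i0 f.
have [t' t'f <-] := complexity_witness tf fnc.
by rewrite -t'f -fun_of_tree_relabel -(leaves_relabel sg) complexity_le_leaves.
Qed.

Lemma complexity_relabel (i0 : 'I_k) sg f :
  complexity (relabel_fun sg f) = complexity f.
Proof.
apply/eqP; rewrite eqn_leq complexity_relabel_le //=.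
rewrite -{1}(relabel_funK sg f); exact: complexity_relabel_le.
Qed.

Lemma essential_relabel sg f i : essential (relabel_fun sg f) (sg i) = essential f i.
Proof.
rewrite /essential; congr negb.
have restrictE b : restrict (relabel_fun sg f) (sg i) b = relabel_fun sg (restrict f i b).
  apply/ffunP => x; rewrite !ffunE; congr (f _); apply/ffunP => j; rewrite !ffunE.
  by rewrite (inj_eq perm_inj).
by rewrite !restrictE (can_eq (relabel_funK sg)).
Qed.

(** Each set is listed and followed by its complement; the permutation matches the entries of equal
    rank in the two lists. *)
Lemma perm_imset (T : finType) (A B : {set T}) : #|A| = #|B| ->
  exists s : {perm T}, s @: B = A.
Proof.
move=> cAB.
pose enum2 (C : {set T}) := enum C ++ enum (~: C)%SET.
have uniq2 C : uniq (enum2 C).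
  rewrite cat_uniq !enum_uniq andbT /=; apply/hasPn => x.
  by rewrite !mem_enum inE.
have mem2 C x : x \in enum2 C by rewrite mem_cat !mem_enum inE orbN.
have size2 C : size (enum2 C) = #|T| by rewrite size_cat -!cardE cardsC.
pose F x := nth x (enum2 A) (index x (enum2 B)).
have lt2 x : (index x (enum2 B) < size (enum2 A))%N.
  by rewrite size2 -(size2 B) index_mem.
have Finj : injective F.
  move=> x y; rewrite /F (set_nth_default x) // => /eqP.
  by rewrite nth_uniq // => /eqP /(congr1 (nth x (enum2 B))); rewrite !nth_index.
exists (perm Finj); apply/eqP; rewrite eqEcard card_imset ?cAB ?leqnn ?andbT; last exact: perm_inj.
apply/fintype.subsetP => _ /imsetP[x xB ->]; rewrite permE /F.
have ltA : (index x (enum2 B) < size (enum A))%N.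
  rewrite -cardE cAB cardE index_cat mem_enum xB.
  by rewrite index_mem mem_enum.
by rewrite nth_cat ltA -(mem_enum A) mem_nth.
Qed.

Definition essentials f : {set 'I_k} := [set i | essential f i]%SET.

Lemma essentials_relabel sg f : essentials (relabel_fun sg f) = sg @: essentials f.
Proof.
apply/setP => i; rewrite !inE -{1}(permKV sg i) essential_relabel.
apply/idP/imsetP => [ei|[j + ->]]; last by rewrite inE permK.
by exists (sg^-1%g i); rewrite ?inE ?permKV.
Qed.

Definition relabel_orbit f : {set boolfun k} :=
  [set relabel_fun sg f | sg : {perm 'I_k}]%SET.

(** The functions of the orbit realise every set of [Ess f] variables as their set of essential
    variables. *)
Lemma card_relabel_orbit f : ('C(k, Ess f) <= #|relabel_orbit f|)%N.
Proof.
apply: (@leq_trans #|essentials @: relabel_orbit f|); last exact: leq_imset_card.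
have := card_draws 'I_k (Ess f); rewrite card_ord => <-.
apply/subset_leq_card/fintype.subsetP => A; rewrite inE => /eqP cA.
have [sg sgA] := perm_imset (A := A) (B := essentials f) cA.
apply/imsetP; exists (relabel_fun sg f); last by rewrite essentials_relabel.
by apply/imsetP; exists sg.
Qed.

End Symmetry.

(** * Boolean functions of patterns *)

Section Pattern_functions.
Variables (R : realType) (k N m : nat).
Local Notation pat := (pat k N).
Local Notation lab := (lab k N).
Hypothesis m_ge2 : (2 <= m)%N.

Definition conn (c : bool) : connective := if c then Conj else Disj.

Lemma is_conj_conn c : is_conj (conn c) = c. Proof. by case: c. Qed.

Definition used h (s : pat h.+1) : seq 'I_N.+1 :=
  [seq i : 'I_N.+1 <- enum 'I_N.+1 | (i < (ar s.1).-1)%N].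

(* Leaves on the spine, which have probability 0 before capping, and the unknown
   part below the pattern are read as False. *)
Fixpoint pfun b h : pat h -> boolfun k :=
  match h return pat h -> boolfun k with
  | 0%N => fun=> [ffun=> false]
  | h'.+1 => fun s =>
      if ar s.1 == 0%N then
        if b then [ffun=> false] else [ffun x : {ffun 'I_k -> bool} => x s.1.2.1 == s.1.2.2]
      else [ffun x => gate_eval (conn (conj_gate s.1))
             [seq (f : boolfun k) x | f <- @pfun b h' s.2.1 ::
                [seq @pfun false h' (s.2.2 i) | i <- used s]]]
  end.

Lemma pfunS b h (s : pat h.+1) : pfun b s =
  if ar s.1 == 0%N then
    if b then [ffun=> false] else [ffun x : {ffun 'I_k -> bool} => x s.1.2.1 == s.1.2.2]
  else [ffun x => gate_eval (conn (conj_gate s.1))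
    [seq (f : boolfun k) x | f <- pfun b s.2.1 :: [seq pfun false (s.2.2 i) | i <- used s]]].
Proof. by []. Qed.

Lemma complexity_cst (b : bool) : complexity ([ffun=> b] : boolfun k) = 0%N.
Proof. by rewrite complexity_const //; exists b => x; rewrite ffunE. Qed.

Lemma complexity_pfunS (i0 : 'I_k) b h (s : pat h.+1) :
  (complexity (pfun b s) <=
   sum_children b (fun b' (s' : pat h) => complexity (pfun b' s')) s)%N.
Proof.
rewrite /sum_children pfunS; case: ifP => _.
  by case: b; rewrite ?complexity_cst // complexity_literal.
apply: leq_trans (complexity_gate i0 _ _) _.
rewrite /= leq_add2l sumnE !big_map big_filter /= big_enum_cond /=.
by apply: eq_leq; apply: eq_bigl => i.
Qed.

Lemma leq_sum_children b h (phi psi : bool -> pat h -> nat) s :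
  (forall b s, phi b s <= psi b s)%N ->
  (sum_children b phi s <= sum_children b psi s)%N.
Proof.
by move=> H; rewrite /sum_children; case: ifP => // _; rewrite leq_add ?leq_sum.
Qed.

Lemma gate_eval_absorbing c bs : ~~ is_conj c \in bs -> gate_eval c bs = ~~ is_conj c.
Proof.
case: c => /= H; last by apply/hasP; exists true.
by apply/negbTE/allPn; exists false.
Qed.

(** If the second child does not have the absorbing value of the gate, then, the literals being
    opposite, the second child of the first child has it. The gates being equal, the first child
    takes this value, which absorbs at the root too. *)
Lemma kill_const h (s : pat h.+2) b : kill m s -> constant_fun (pfun b s).
Proof.
case: h s => // h s /andP[/and3P[/eqP am /eqP am0 /eqP cc]].
move=> /and3P[/eqP a1 /eqP a01 /eqP l01].
have m0 : (m == 0%N) = false by case: m m_ge2.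
have ltm : (0 < m.-1)%N by case: m m_ge2 => [|[]].
have in_used h' (s' : pat h'.+1) : ar (root_lab s') = m -> ord0 \in used s'.
  by move=> E; rewrite mem_filter mem_enum andbT -[s'.1]/(root_lab s') E.
exists (~~ conj_gate (root_lab s)) => x.
rewrite pfunS -[s.1]/(root_lab s) am m0 ffunE.
rewrite -{2}[conj_gate _]is_conj_conn; apply: gate_eval_absorbing.
rewrite is_conj_conn /= inE.
have [e1|e1] := eqVneq (~~ conj_gate (root_lab s)) (pfun false (children s ord0) x).
  apply/orP; right; rewrite -map_comp; apply/mapP; exists ord0 => //.
  exact: in_used.
apply/orP; left; rewrite -[s.2.1.1]/(root_lab (first_child s)) am0 m0 ffunE.
rewrite eq_sym -cc; apply/eqP.
rewrite -[in RHS](is_conj_conn (conj_gate (root_lab s))); apply: gate_eval_absorbing.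
rewrite is_conj_conn inE; apply/orP; right; rewrite -map_comp; apply/mapP; exists ord0.
  exact: in_used.
move: e1; rewrite /= -[(children s ord0).1]/(root_lab (children s ord0)) a1 eqxx.
rewrite -[(s.2.1.2.2 ord0).1]/(root_lab (children (first_child s) ord0)) a01 eqxx l01 /=.
rewrite !ffunE.
by case: (conj_gate _); case: (x _); case: (_.2).
Qed.

(** Subadditivity over two generations, killed vertices being constant. At depth 1 a gate has
    constant inputs only. *)
Lemma complexity_pfun_le (i0 : 'I_k) b j (s : pat j.*2.+1) :
  (complexity (pfun b s) <= trimmed_size m b s)%N.
Proof.
elim: j b s => [|j IH] b s.
  rewrite pfunS; case: ifP => _.
    by case: b; rewrite ?complexity_cst // complexity_literal.
  apply: leq_trans (complexity_gate i0 _ _) _.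
  rewrite /= complexity_cst add0n sumnE !big_map big1 // => i _.
  exact: complexity_cst.
rewrite doubleS in s *; rewrite [trimmed_size m b s]/= -[kill_lab _ _ _ _ _]/(kill m s).
case: ifP => [ks|_]; first by rewrite complexity_const //; apply: kill_const.
apply: leq_trans (complexity_pfunS i0 b s) _; apply: leq_sum_children => b1 s1.
apply: leq_trans (complexity_pfunS i0 b1 s1) _; apply: leq_sum_children => b2 s2.
exact: IH.
Qed.

Definition relabel_lab (sg : {perm 'I_k}) (x : lab) : lab := (x.1, (sg x.2.1, x.2.2)).

Fixpoint relabel_pat sg h : pat h -> pat h :=
  match h return pat h -> pat h with
  | 0%N => id
  | h'.+1 => fun s => (relabel_lab sg s.1,
      (@relabel_pat sg h' s.2.1, [ffun i => @relabel_pat sg h' (s.2.2 i)]))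
  end.

Lemma relabel_patK sg h : cancel (@relabel_pat sg h) (@relabel_pat sg^-1%g h).
Proof.
elim: h => [|h IH] s //=; rewrite IH.
case: s => [[y [i c]] [s0 g]] /=; rewrite /relabel_lab /= permK; congr (_, (_, _)).
by apply/ffunP => j; rewrite !ffunE IH.
Qed.

Lemma pfun_relabel sg b h (s : pat h) :
  pfun b (relabel_pat sg s) = relabel_fun sg (pfun b s).
Proof.
elim: h b s => [|h IH] b s; first by apply/ffunP => x; rewrite !ffunE.
apply/ffunP => x; rewrite !pfunS /used /=.
rewrite -[ar (relabel_lab sg s.1)]/(ar s.1) ffunE.
case: ifP => [_|_]; first by case: b; rewrite !ffunE.
rewrite !ffunE; congr gate_eval => /=; rewrite IH [relabel_fun _ _ _]ffunE.
congr (_ :: _); rewrite -!map_comp; apply: eq_map => i /=.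
by rewrite ffunE IH ffunE.
Qed.

Variable nu : bool -> 'I_N.+3 -> R.

Lemma wt_relabel sg b h (s : pat h) : wt nu b (relabel_pat sg s) = wt nu b s.
Proof.
elim: h b s => [|h IH] b s //=; rewrite IH; congr (_ * (_ * _)).
by apply: eq_bigr => i _; rewrite ffunE IH.
Qed.

Hypothesis nu_ge0 : forall b n, 0 <= nu b n.

(** Relabelling preserves weights, so every function of the orbit has the weight of [f]. The
    corresponding events are disjoint, and lie in the event on the right because complexity is
    constant on the orbit. *)
Lemma binomial_pfun_le (i0 : 'I_k) j (f : boolfun k) :
  ('C(k, Ess f))%:R * \sum_(s : pat j.*2.+1 | pfun true s == f) wt nu true s <=
  Ex nu true (fun s : pat j.*2.+1 => (complexity f <= trimmed_size m true s)%N%:R).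
Proof.
set W := fun f => \sum_(s : pat j.*2.+1 | pfun true s == f) wt nu true s.
have W0 : 0 <= W f by apply: sumr_ge0 => s _; apply: wt_ge0.
have WE f' : f' \in relabel_orbit f -> W f' = W f.
  case/imsetP => sg _ ->; rewrite /W (reindex_inj (can_inj (@relabel_patK sg _))).
  apply: eq_big => s; last by move=> _; rewrite wt_relabel.
  by rewrite pfun_relabel (can_eq (relabel_funK sg)).
apply: (@le_trans _ _ (\sum_(f' in relabel_orbit f) W f')).
  rewrite (eq_bigr _ WE) sumr_const -[leRHS]mulr_natl ler_wpM2r // ler_nat.
  exact: card_relabel_orbit.
rewrite (eq_bigr (fun f' => \sum_(s : pat j.*2.+1 | (pfun true s \in relabel_orbit f)
    && (pfun true s == f')) wt nu true s)); last first.
  move=> f' f'O; apply: eq_bigl => s.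
  by case: eqP => [->|_]; rewrite ?f'O ?andbF.
rewrite -(partition_big _ (fun f' => f' \in relabel_orbit f)) // /Ex.
rewrite big_mkcond; apply: ler_sum => s _.
case: ifP => [/imsetP[sg _ sE]|_]; last by rewrite mulr_ge0 ?wt_ge0.
rewrite (_ : (complexity f <= trimmed_size m true s)%N) ?mulr1 //.
by rewrite -(complexity_relabel i0 sg) -sE complexity_pfun_le.
Qed.

End Pattern_functions.

(** * Independence of disjoint subtrees *)

Section Cylinders.
Variables (R : realType) (mu : nat -> \bar R) (k : nat) (d : measure_display).
Variables (Omega : measurableType d) (P : probability Omega R) (T : Omega -> ltree k).
Hypothesis HT : random_labelled_Tinfty mu P T.
Local Open Scope ereal_scope.

Definition vertex (i : source) : seq nat :=
  match i with inl v | inr (inl v) | inr (inr v) => v end.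

Definition below (v : seq nat) : pred source := fun i => prefix v (vertex i).

(** Finite intersections with one event per source, the form to which [mutually_independent] applies
    directly. *)
Definition cyl (J : pred source) (E : set Omega) : Prop :=
  exists (s : seq source) (A : source -> set Omega),
    [/\ uniq s, all J s, forall i, i \in s -> source_sigma T i (A i) &
        E = \big[setI/[set: Omega]]_(i <- s) A i].

Lemma cyl_measurable J E : cyl J E -> measurable E.
Proof.
case: HT => mG _ _ _ _ [s [A [_ _ GA ->]]]; rewrite big_seq.
by elim/big_ind : _ => // [X Y|i /GA]; [apply: measurableI|apply: mG].
Qed.

Lemma cyl_setT J : cyl J [set: Omega].
Proof. by exists [::], (fun=> setT); split=> //; rewrite big_nil. Qed.

Lemma cyl_source (J : pred source) i E : J i -> source_sigma T i E -> cyl J E.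
Proof.
move=> Ji Ei; exists [:: i], (fun=> E); rewrite big_seq1 /= Ji; split=> // j.
by rewrite inE => /eqP ->.
Qed.

Lemma cyl_sub (J J' : pred source) E : subpred J J' -> cyl J E -> cyl J' E.
Proof.
move=> JJ' [s [A [us Js GA ->]]]; exists s, A; split=> //.
exact: sub_all Js.
Qed.

Lemma cylI (J1 J2 : pred source) E1 E2 : cyl J1 E1 -> cyl J2 E2 ->
  (forall i, J1 i -> ~~ J2 i) ->
  cyl (predU J1 J2) (E1 `&` E2) /\ P (E1 `&` E2) = P E1 * P E2.
Proof.
case: HT => _ indep _ _ _ [s1 [A1 [us1 Js1 GA1 ->]]] [s2 [A2 [us2 Js2 GA2 ->]]] J12.
have s12 i : i \in s2 -> i \notin s1.
  by move=> /(allP Js2) J2i; apply: contraTN J2i => /(allP Js1) /J12.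
(* A single family over the concatenated list, so that independence can be used for both lists and
   for their union. *)
pose A i := if i \in s1 then A1 i else A2 i.
have us : uniq (s1 ++ s2).
  rewrite cat_uniq us1 us2 andbT /=; apply/hasPn => i /s12; exact.
have GA i : i \in s1 ++ s2 -> source_sigma T i (A i).
  rewrite mem_cat /A; case: ifP => [i1 _|_ /= i2]; [exact: GA1|exact: GA2].
have E1E : \big[setI/[set: Omega]]_(i <- s1) A1 i = \big[setI/[set: Omega]]_(i <- s1) A i.
  by apply: eq_big_seq => i i1; rewrite /A i1.
have E2E : \big[setI/[set: Omega]]_(i <- s2) A2 i = \big[setI/[set: Omega]]_(i <- s2) A i.
  by apply: eq_big_seq => i i2; rewrite /A (negbTE (s12 _ i2)).
rewrite E1E E2E -big_cat; split.
  exists (s1 ++ s2), A; split=> //; rewrite all_cat; apply/andP; split.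
    by apply: sub_all Js1 => i /= ->.
  by apply: sub_all Js2 => i /= ->; rewrite orbT.
rewrite !indep //; first exact: big_cat.
- by move=> i i2; apply: GA; rewrite mem_cat i2 orbT.
- by move=> i i1; apply: GA; rewrite mem_cat i1.
Qed.

Lemma cyl_bigI n (E : nat -> set Omega) (J : nat -> pred source) :
  (forall i, (i < n)%N -> cyl (J i) (E i)) ->
  (forall i j x, (i < j)%N -> J i x -> ~~ J j x) ->
  cyl (fun x => has (J^~ x) (iota 0 n)) (\big[setI/[set: Omega]]_(i < n) E i) /\
  P (\big[setI/[set: Omega]]_(i < n) E i) = \prod_(i < n) P (E i).
Proof.
move=> cE J12; elim: n cE => [|n IH] cE.
  by rewrite !big_ord0 probability_setT; split=> //; apply: cyl_setT.
have [c1 P1] := IH (fun i Hi => cE i (ltnW Hi)).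
have iotaS : iota 0 n.+1 = iota 0 n ++ [:: n] by rewrite -[n.+1]addn1 iotaD.
rewrite iotaS !big_ord_recr /=.
have disj x : has (J^~ x) (iota 0 n) -> ~~ J n x.
  case/hasP => i; rewrite mem_iota add0n => /andP[_ Hi]; exact: J12.
have [c2 P2] := cylI c1 (cE n (ltnSn n)) disj.
rewrite P2 P1; split=> //; apply: cyl_sub c2 => x /=.
by rewrite has_cat /= orbF.
Qed.

(** The arity, gate and literal at [v] and the subtrees of its children depend on pairwise disjoint
    sets of sources. *)
Lemma cyl_node v (A : set nat) (B : set connective) (C : set (literal k)) n
    (E : nat -> set Omega) :
  (forall i, (i < n)%N -> cyl (below (rcons v i)) (E i)) ->
  let F := [set w | A (arity (T w) v)] `&` ([set w | B (gate (T w) v)] `&`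
    ([set w | C (lit (T w) v)] `&` \big[setI/[set: Omega]]_(i < n) E i)) in
  cyl (below v) F /\
  P F = P [set w | A (arity (T w) v)] * (P [set w | B (gate (T w) v)] *
    (P [set w | C (lit (T w) v)] * \prod_(i < n) P (E i))).
Proof.
move=> cE /=.
have disj i j x : (i < j)%N -> below (rcons v i) x -> ~~ below (rcons v j) x.
  rewrite /below => ij /prefixP[s1 s1E]; apply/negP => /prefixP[s2].
  rewrite s1E !cat_rcons => /eqP; rewrite eqseq_cat // eqxx /= eqseq_cons.
  by case/andP => /eqP ijE; rewrite ijE ltnn in ij.
have [cI PI] := cyl_bigI cE disj.
pose J0 x := has ((fun i => below (rcons v i))^~ x) (iota 0 n).
have nroot x : J0 x -> (size v < size (vertex x))%N.
  case/hasP => i _ /prefixP[s ->]; rewrite size_cat size_rcons; lia.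
have c3 : cyl (pred1 (inr (inr v))) [set w | C (lit (T w) v)].
  by apply: (@cyl_source _ (inr (inr v))); [exact: eqxx|exists C].
have c2 : cyl (pred1 (inr (inl v))) [set w | B (gate (T w) v)].
  by apply: (@cyl_source _ (inr (inl v))); [exact: eqxx|exists B].
have c1 : cyl (pred1 (inl v)) [set w | A (arity (T w) v)].
  by apply: (@cyl_source _ (inl v)); [exact: eqxx|exists A].
have nJ0 x : vertex x = v -> ~~ J0 x.
  by move=> xv; apply/negP => /nroot; rewrite xv ltnn.
have [|c4 P4] := cylI c3 cI; first by move=> x /eqP ->; apply: nJ0.
have [|c5 P5] := cylI c2 c4.
  by move=> x /eqP ->; apply/norP; split; [|apply: nJ0].
have [|c6 P6] := cylI c1 c5.
  by move=> x /eqP ->; apply/norP; split; [|apply/norP; split; [|apply: nJ0]].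
rewrite P6 P5 P4 PI; split=> //; apply: cyl_sub c6 => x /=.
rewrite /below; case/orP => [/eqP ->|/orP[/eqP ->|/orP[/eqP ->|]]]; rewrite ?prefix_refl //.
by case/hasP => i _; apply: prefix_trans; rewrite -cats1 prefix_prefix.
Qed.

End Cylinders.

(** * Law of the truncated random tree *)

Section Truncation.
Variables (R : realType) (mu : nat -> R) (k : nat) (d : measure_display).
Variables (Omega : measurableType d) (P : probability Omega R) (T : Omega -> ltree k).
Hypothesis HT : random_labelled_Tinfty (fun n => (mu n)%:E) P T.
Hypothesis k_gt0 : (0 < k)%N.
Variable N : nat.

(** Positions outside the tree are read too, so that the law is an exact product; [insubd ord0]
    sends arities above the cap to 0. *)
Fixpoint trunc h (t : ltree k) (v : seq nat) : pat k N h :=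
  match h return pat k N h with
  | 0%N => tt
  | h'.+1 => ((insubd ord0 (arity t v), is_conj (gate t v), lit t v),
      (trunc h' t (rcons v 0%N), [ffun i : 'I_N.+1 => trunc h' t (rcons v i.+1)]))
  end.

Lemma prob_arity v n : P [set w | arity (T w) v = n] = (offspring mu (on_spine v) n)%:E.
Proof. by case: HT => _ _ -> _ _; rewrite /offspring /size_biased; case: ifP. Qed.

Lemma prob_capped v (n : 'I_N.+3) :
  P [set w | insubd ord0 (arity (T w) v) = n] = (capped mu (on_spine v) n)%:E.
Proof.
have mE (i : 'I_N.+3) : measurable [set w | arity (T w) v = i].
  by case: HT => mG _ _ _ _; apply: (mG (inl v)); exists [set (i : nat)].
rewrite /capped; have [->|n0] := eqVneq n ord0; last first.
  rewrite -prob_arity; congr (P _); apply/seteqP; split=> w /=.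
    move=> E; move: n0; rewrite -E /insubd; case: insubP => [u _ <- //|_].
    by rewrite eqxx.
  by move=> E; apply: val_inj; rewrite val_insubd E ltn_ord.
(* The value 0 is the complement of the finitely many other values, in accordance with the form of
   [capped]. *)
pose D : {pred 'I_N.+3} := fun i => i != ord0.
have -> : [set w | insubd ord0 (arity (T w) v) = ord0 :> 'I_N.+3] =
    ~` \big[setU/set0]_(i < N.+3 | D i) [set w | arity (T w) v = i].
  apply/seteqP; split=> w /=.
    rewrite -bigcup_seq_cond => E [i /= /andP[_ i0] wi].
    move: i0; rewrite /D -E -(inj_eq val_inj) val_insubd wi ltn_ord eqxx //.
  move=> H; apply: val_inj; rewrite val_insubd /=; case: ifP => // lt.
  apply/eqP; apply: contrapT => /negP n0; apply: H.
  rewrite -bigcup_seq_cond; exists (Ordinal lt) => //=; apply/andP; split=> //.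
  by rewrite mem_index_enum.
rewrite probability_setC; last by apply: bigsetU_measurable => i _; apply: mE.
rewrite measure_bigsetU_ord_cond //; last first.
  by move=> i j _ _ [w [/= -> /val_inj]].
rewrite EFinB -sumEFin; congr (_ - _)%E.
by apply: eq_bigr => i _; apply: prob_arity.
Qed.

Lemma wt_trunc h v (s : pat k N h) :
  cyl T (below v) [set w | trunc h (T w) v = s] /\
  P [set w | trunc h (T w) v = s] = (wt (@capped R mu N) (on_spine v) s)%:E.
Proof.
elim: h v s => [|h IH] v s.
  have -> : [set w | trunc 0 (T w) v = s] = setT.
    by apply/seteqP; split=> // w _ /=; case: s.
  by rewrite probability_setT; split=> //; apply: cyl_setT.
(* Child 0 is kept in [s.2.1], child [i.+1] in [s.2.2 i]. *)
pose child i := if i is i'.+1 then s.2.2 (inord i') else s.2.1.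
pose E i := [set w | trunc h (T w) (rcons v i) = child i].
have cE i : (i < N.+2)%N -> cyl T (below (rcons v i)) (E i) by case: (IH (rcons v i) (child i)).
have [c1 P1] := cyl_node HT (fun n => insubd ord0 n = s.1.1.1) (fun c => is_conj c = s.1.1.2)
  (fun l => l = s.1.2) cE.
have setE : [set w | trunc h.+1 (T w) v = s] =
    [set w | insubd ord0 (arity (T w) v) = s.1.1.1] `&`
    ([set w | is_conj (gate (T w) v) = s.1.1.2] `&`
    ([set w | lit (T w) v = s.1.2] `&` \big[setI/[set: Omega]]_(i < N.+2) E i)).
  apply/seteqP; split=> w /=.
    move=> sE; do 3 (split; first by rewrite -sE).
    rewrite -bigcap_mkord => i /= Hi; rewrite /E /child -sE /=.
    case: i Hi => // i Hi; by rewrite ffunE inordK.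
  move=> [E1 [E2 [E3]]]; rewrite -bigcap_mkord => E4.
  have E40 := E4 0%N isT.
  have E4S (i : 'I_N.+1) : trunc h (T w) (rcons v i.+1) = s.2.2 i.
    by have := E4 i.+1 (ltn_ord i); rewrite /E /= inord_val.
  move: E1 E2 E3 E40 E4S; rewrite /E /child /= => -> -> -> ->.
  case: s {child E cE c1 P1 E4} => [[[n c] l] [s0 g]] /= E4.
  by congr (_, (_, _)); apply/ffunP => i; rewrite ffunE E4.
rewrite setE; split=> //; rewrite P1 prob_capped.
have -> : P [set w | is_conj (gate (T w) v) = s.1.1.2] = (2^-1)%:E.
  case: HT => _ _ _ Hg _; rewrite -(Hg v (conn s.1.1.2)); congr (P _).
  by apply/seteqP; split=> w /=; case: (gate _ _); case: s.1.1.2.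
have -> : P [set w | lit (T w) v = s.1.2] = ((2 * k)%N%:R^-1)%:E by case: HT => _ _ _ _ ->.
rewrite /= big_ord_recl /=.
have -> : P (E 0%N) = (wt (@capped R mu N) (on_spine v) s.2.1)%:E.
  case: (IH (rcons v 0%N) s.2.1) => _ ->.
  by rewrite /on_spine all_rcons /=.
rewrite (eq_bigr (fun i : 'I_N.+1 => (wt (@capped R mu N) false (s.2.2 i))%:E)); last first.
  move=> i _; case: (IH (rcons v i.+1) (s.2.2 i)) => _; rewrite /on_spine all_rcons /= => <-.
  by rewrite /E /child /bump /= inord_val.
rewrite prodEFin -!EFinM; congr (_%:E); rewrite /wlab -!mulrA; congr (_ * _).
have k0 : (k%:R : R) != 0 by rewrite pnatr_eq0 -lt0n.
rewrite !natrM; set x := wt _ _ _; set y := bigop.body _ _ _.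
by field.
Qed.

Lemma prob_trunc_le h (A : pred (pat k N h)) :
  measurable [set w | A (trunc h (T w) [::])] /\
  (P [set w | A (trunc h (T w) [::])] <=
    (\sum_(s | A s) wt (@capped R mu N) true s)%:E)%E.
Proof.
have ms s : measurable [set w | trunc h (T w) [::] = s].
  by have [c _] := wt_trunc [::] s; apply: cyl_measurable HT _ _ c.
have -> : [set w | A (trunc h (T w) [::])] =
    \big[setU/set0]_(s | A s) [set w | trunc h (T w) [::] = s].
  rewrite -bigcup_seq_cond; apply/seteqP; split=> w /=.
    by move=> Aw; exists (trunc h (T w) [::]) => //=; rewrite mem_index_enum.
  by move=> [s /= /andP[_ As] ->].
split; first by apply: bigsetU_measurable => s _.
have [_ +] : measurable (\big[setU/set0]_(s | A s) [set w | trunc h (T w) [::] = s]) /\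
    (P (\big[setU/set0]_(s | A s) [set w | trunc h (T w) [::] = s])
      <= \sum_(s | A s) P [set w | trunc h (T w) [::] = s])%E.
  elim/big_rec2 : _ => [|s y B As [mB PB]]; first by rewrite measure0.
  split; first exact: measurableU.
  apply: (le_trans (measureU2 P (ms s) mB)). exact: leeD2l.
move/le_trans; apply; rewrite -sumEFin; apply: lee_sum => s _.
by have [_ ->] := wt_trunc [::] s.
Qed.

End Truncation.

(** * The upper bound *)

Section Represents.
Variables (k : nat) (i0 : 'I_k).
Implicit Types (t : ltree k) (v : seq nat) (s : aotree k).

Definition false_tree : aotree k := Node Conj (Leaf (i0, true)) (Leaf (i0, false)) [::].

(** The cut at depth [h] uses [false_tree], in accordance with the value False that [pfun] gives to
    what lies below a pattern. *)
Fixpoint fill h t v : aotree k :=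
  if h is h'.+1 then
    if arity t v == 0%N then Leaf (lit t v) else
    Node (gate t v) (fill h' t (rcons v 0%N)) (fill h' t (rcons v 1%N))
      [seq fill h' t (rcons v i) | i <- iota 2 (arity t v - 2)]
  else false_tree.

Definition no_unary t := forall v, arity t v <> 1%N.
Definition infinite_spine t := forall v, on_spine v -> arity t v <> 0%N.

(** One level more than [h]: a vertex at height [h] must show its status and its gate. *)
Lemma coincide_fill h t v : no_unary t -> coincide h t v (fill h.+1 t v).
Proof.
move=> t1; elim: h v => [|h IH] v.
  rewrite /=; case: eqP => [a0|/eqP a0] //=; by rewrite lt0n.
rewrite [fill _ _ _]/= -/(fill h.+1 t _).
have := t1 v; case: eqP => [a0 _|/eqP a0 a1]; first by split.
have a2 : (2 <= arity t v)%N by case: (arity t v) a0 a1 => [|[|]].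
split; rewrite ?lt0n //; split; first by rewrite /= size_map size_iota; lia.
move=> [|[|i]] Hi; [exact: IH|exact: IH|].
rewrite [nth _ _ _]/= (nth_map 0%N) ?size_iota; last lia.
by rewrite nth_iota; [exact: IH|lia].
Qed.

Lemma coincideS h t v s : coincide h.+1 t v s -> coincide h t v s.
Proof.
elim: h v s => [|h IH] v [l|c s1 s2 ss] //; first by case.
case=> a0 g [aE H]; split=> //; split=> // i Hi.
exact: IH (H i Hi).
Qed.

Lemma coincide_leq h h' t v s : (h <= h')%N -> coincide h' t v s -> coincide h t v s.
Proof.
move=> /subnK <-; elim: (h' - h)%N => // n IH; rewrite addSn => /coincideS; exact: IH.
Qed.

Lemma represents_fill t f : no_unary t -> represents t f ->
  exists h0, forall h, (h0 < h)%N -> fun_of_tree (fill h t [::]) = f.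
Proof.
move=> t1 [h0 [_ Hf]]; exists h0 => -[//|h] h0h.
by apply: Hf; apply: (@coincide_leq h0 h _ _ _ h0h); apply: coincide_fill.
Qed.

Fixpoint arity_bounded M h t v : Prop :=
  if h is h'.+1 then (arity t v <= M)%N /\
    forall i, (i < arity t v)%N -> arity_bounded M h' t (rcons v i)
  else True.

Lemma arity_bounded_ex h t v : exists M0, forall M, (M0 <= M)%N -> arity_bounded M h t v.
Proof.
elim: h v => [|h IH] v; first by exists 0%N.
have [M0 HM0] := choice (fun i => IH (rcons v i)).
exists (maxn (arity t v) (\max_(i < arity t v) M0 i)) => M.
rewrite geq_max => /andP[aM H] /=; split=> // i Hi; apply: HM0.
apply: leq_trans H; exact: (leq_bigmax (Ordinal Hi)).
Qed.

Lemma map_used N h (s : pat k N h.+1) : map val (used s) = iota 0 (ar s.1).-1.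
Proof.
rewrite /used; have : ((ar s.1).-1 <= N.+1)%N by have := ar_lt s.1; lia.
move: (ar s.1).-1 => n le_n.
rewrite -[LHS](seq.filter_map val (fun i => i < n)%N) val_enum_ord.
apply: (irr_sorted_eq ltn_trans ltnn) => //.
- exact: sorted_filter ltn_trans _ _ (iota_ltn_sorted _ _).
- exact: iota_ltn_sorted.
by move=> i; rewrite mem_filter !mem_iota; lia.
Qed.

(** When the cap is at least all arities above the cut, truncation alters none of them. *)
Lemma pfun_trunc N h t v : no_unary t -> infinite_spine t ->
  arity_bounded N.+2 h t v ->
  pfun (on_spine v) (trunc N h t v) = fun_of_tree (fill h t v).
Proof.
move=> t1 tsp; elim: h v => [|h IH] v.
  by move=> _; apply/ffunP => x; rewrite !ffunE /=; case: (x i0).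
case=> aM ac; have arE : ar (trunc N h.+1 t v).1 = arity t v.
  by rewrite /ar /= val_insubd ltnS aM.
rewrite pfunS arE [fill _ _ _]/=; have := t1 v; case: eqP => [a0 _|/eqP a0 a1].
  case: ifP => [/tsp //|_]; by apply/ffunP => x; rewrite !ffunE.
have a2 : (2 <= arity t v)%N by case: (arity t v) a0 a1 => [|[|]].
apply/ffunP => x; rewrite !ffunE eval_Node.
have -> : conn (conj_gate (trunc N h.+1 t v).1) = gate t v.
  by rewrite /conj_gate /=; case: (gate t v).
congr gate_eval; rewrite /=.
have sp0 : on_spine (rcons v 0%N) = on_spine v by rewrite /on_spine all_rcons.
rewrite -{1}sp0 IH ?ffunE; last by apply: ac; lia.
congr (_ :: _); rewrite -map_comp.
pose G i := eval x (fill h t (rcons v i.+1)).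
transitivity (map G (map val (used (trunc N h.+1 t v)))).
  rewrite -map_comp; apply/eq_in_map => i; rewrite mem_filter arE => /andP[Hi _].
  rewrite /= ffunE.
  have spS : on_spine (rcons v i.+1) = false by rewrite /on_spine all_rcons.
  by rewrite -spS IH ?ffunE //; apply: ac; lia.
rewrite map_used arE /G -map_comp.
have -> : (arity t v).-1 = (arity t v - 2).+1 by lia.
rewrite /= -[2%N]/(1 + 1)%N iotaDl -map_comp; congr (_ :: _).
Qed.

(** Embedding into generic trees, whence the countability on which measurability relies; node number
    1 stands for [Conj]. *)
Fixpoint tree_code s : GenTree.tree ('I_k * bool)%type :=
  match s with
  | Leaf l => GenTree.Leaf l
  | Node c s1 s2 ss => GenTree.Node (is_conj c) [:: tree_code s1, tree_code s2 & map tree_code ss]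
  end.

Fixpoint tree_decode (g : GenTree.tree ('I_k * bool)%type) : aotree k :=
  match g with
  | GenTree.Leaf l => Leaf l
  | GenTree.Node n (g1 :: g2 :: gs) =>
      Node (conn (0 < n)%N) (tree_decode g1) (tree_decode g2) (map tree_decode gs)
  | _ => false_tree
  end.

Lemma tree_codeK : cancel tree_code tree_decode.
Proof.
elim/aotree_nested_ind => // c t1 t2 ts IH /=.
rewrite (IH 0%N isT) (IH 1%N isT) -map_comp; congr Node; first by case: c.
apply: (@eq_from_nth _ t1); rewrite !size_map // => i Hi.
by rewrite (nth_map t1) //=; apply: (IH i.+2).
Qed.

Definition nth_tree (n : nat) : aotree k :=
  if unpickle n is Some g then tree_decode g else false_tree.

Lemma nth_tree_surj s : exists n, nth_tree n = s.
Proof. by exists (pickle (tree_code s)); rewrite /nth_tree pickleK tree_codeK. Qed.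

End Represents.

(** * Passage from patterns to the infinite tree *)

Section Upper_bound.
Variables (R : realType).

(** The tail intersections increase and each has probability at most [B]; continuity from below
    passes this to their union. *)
Lemma prob_liminf_le d (Omega : measurableType d) (P : probability Omega R)
    (E : nat -> set Omega) (B : \bar R) :
  (forall n, measurable (E n)) -> (forall n, P (E n) <= B)%E ->
  measurable (\bigcup_n \bigcap_(i in [set i | (n <= i)%N]) E i) /\
  (P (\bigcup_n \bigcap_(i in [set i | (n <= i)%N]) E i) <= B)%E.
Proof.
move=> mE PE; pose F n := \bigcap_(i in [set i | (n <= i)%N]) E i.
have mF n : measurable (F n) by apply: bigcap_measurable => //; exists n => /=.
have mU : measurable (\bigcup_n F n) by apply: bigcupT_measurable.
split=> //.
have homF : {homo F : n m / (n <= m)%N >-> (n <= m)%O}.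
  move=> n m nm; apply/subsetPset => w Fw i /= mi; apply: Fw => /=; exact: leq_trans mi.
have cvF := nondecreasing_cvg_mu (mu := P) mF mU homF.
rewrite -(cvg_lim _ cvF) //; apply: lime_le; first by apply/cvg_ex; exists (P (\bigcup_n F n)).
near=> n; apply: le_trans (PE n); apply: le_measure; [exact/mem_set|exact/mem_set|].
by move=> w; apply => /=.
Unshelve. all: by end_near.
Qed.

Variables (mu : nat -> R) (k : nat) (d : measure_display).
Variables (Omega : measurableType d) (P : probability Omega R) (T : Omega -> ltree k).
Hypothesis HT : random_labelled_Tinfty (fun n => (mu n)%:E) P T.
Hypothesis k_gt0 : (0 < k)%N.
Hypothesis mu1 : mu 1%N = 0.

Let i0 : 'I_k := Ordinal k_gt0.

Lemma measurable_arity v (A : set nat) : measurable [set w | A (arity (T w) v)].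
Proof. by case: HT => mG _ _ _ _; apply: (mG (inl v)); exists A. Qed.

Lemma measurable_coincide h v s : measurable [set w | coincide h (T w) v s].
Proof.
have mgate u (A : set connective) : measurable [set w | A (gate (T w) u)].
  by case: HT => mG _ _ _ _; apply: (mG (inr (inl u))); exists A.
have mlit u (A : set (literal k)) : measurable [set w | A (lit (T w) u)].
  by case: HT => mG _ _ _ _; apply: (mG (inr (inr u))); exists A.
elim: h v s => [|h IH] v [l|c s1 s2 ss].
- exact: measurableI (measurable_arity v (eq^~ 0%N)) (mlit v (eq^~ l)).
- have -> : [set w | coincide 0 (T w) v (Node c s1 s2 ss)] =
    [set w | (0 < arity (T w) v)%N] `&` [set w | gate (T w) v = c].
    by apply/seteqP; split=> w /= []; split.
  exact: measurableI (measurable_arity v (fun n => 0 < n)%N) (mgate v (eq^~ c)).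
- exact: measurableI (measurable_arity v (eq^~ 0%N)) (mlit v (eq^~ l)).
set ch := [:: s1, s2 & ss].
have -> : [set w | coincide h.+1 (T w) v (Node c s1 s2 ss)] =
    [set w | arity (T w) v = size ch] `&` ([set w | gate (T w) v = c] `&`
    \bigcap_(i in [set i | (i < size ch)%N])
      [set w | coincide h (T w) (rcons v i) (nth (Node c s1 s2 ss) ch i)]).
  apply/seteqP; split=> w /= => [[a0 g [aE H]]|[aE [g H]]].
    by split=> //; split=> // i /= Hi; apply: H; rewrite aE.
  by split=> //; [rewrite aE|split=> // i; rewrite aE; apply: H].
apply: measurableI; first exact: (measurable_arity v (eq^~ (size ch))).
apply: measurableI; first exact: (mgate v (eq^~ c)).
by apply: bigcap_measurable => [|i _]; [exists 0%N|exact: IH].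
Qed.

(** As [nth_tree] enumerates all finite trees, both quantifiers over trees become countable
    operations. *)
Lemma measurable_represents f : measurable [set w | represents (T w) f].
Proof.
have -> : [set w | represents (T w) f] =
    \bigcup_h ((\bigcup_n [set w | coincide h (T w) [::] (nth_tree i0 n)]) `&`
      \bigcap_(n in [set n | fun_of_tree (nth_tree i0 n) <> f])
         ~` [set w | coincide h (T w) [::] (nth_tree i0 n)]).
  apply/seteqP; split=> w /=.
    move=> [h [[s sw] Hf]]; exists h => //; split.
      by have [n ns] := nth_tree_surj i0 s; exists n => //=; rewrite ns.
    by move=> n /= nf /Hf.
  move=> [h _ [[n _ nw] H]]; exists h; split; first by exists (nth_tree i0 n).
  move=> s sw; apply: contrapT => sf; have [n' ns] := nth_tree_surj i0 s.
  by apply: (H n') => /=; rewrite ns.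
apply: bigcupT_measurable => h; apply: measurableI.
  by apply: bigcupT_measurable => n; apply: measurable_coincide.
apply: bigcap_measurableType => n _; apply: measurableC; exact: measurable_coincide.
Qed.

(** All sequences are taken, vertices of the tree or not: each single event is null, as [mu 1 = 0]
    and the size-biased law gives no mass to 0. *)
Definition degenerate : set Omega := \bigcup_n [set w | let v := odflt [::] (unpickle n) in
  arity (T w) v = 1%N \/ (on_spine v /\ arity (T w) v = 0%N)].

Lemma degenerate_null : measurable degenerate /\ P degenerate = 0.
Proof.
have m1 v n : measurable [set w | arity (T w) v = n] := measurable_arity v (eq^~ n).
pose F n := [set w | let v := odflt [::] (unpickle n) in
  arity (T w) v = 1%N \/ (on_spine v /\ arity (T w) v = 0%N)] : set Omega.
have mF n : measurable (F n) /\ P (F n) = 0.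
  rewrite /F; set v := odflt _ _.
  have z1 : P [set w | arity (T w) v = 1%N] = 0.
    by rewrite (prob_arity HT) /offspring mu1 mulr0; case: ifP.
  have [sp|nsp] := boolP (on_spine v).
    have -> : [set w | let v := v in arity (T w) v = 1%N \/ true /\ arity (T w) v = 0%N] =
        [set w | arity (T w) v = 1%N] `|` [set w | arity (T w) v = 0%N].
      by apply/seteqP; split=> w /= [->|]; [left|case; right|left|right].
    have z0 : P [set w | arity (T w) v = 0%N] = 0.
      by rewrite (prob_arity HT) /offspring sp mul0r.
    split; first exact: measurableU.
    apply/eqP; rewrite eq_le measure_ge0 andbT.
    apply: (@le_trans _ _ (P [set w | arity (T w) v = 1%N] +
      P [set w | arity (T w) v = 0%N])%E); first exact: measureU2.
    by rewrite z0 z1 adde0.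
  have -> : [set w | let v := v in arity (T w) v = 1%N \/ false /\ arity (T w) v = 0%N] =
      [set w | arity (T w) v = 1%N].
    by apply/seteqP; split=> w /=; [case=> // -[]|left].
  by split.
have mbad : measurable degenerate by apply: bigcupT_measurable => n; case: (mF n).
split=> //.
have : P.-negligible degenerate.
  by apply: negligible_bigcup => n; have [mFn Fn0] := mF n; apply/negligibleP.
by move/negligibleP => ->.
Qed.

Lemma not_degenerate w : ~ degenerate w -> no_unary (T w) /\ infinite_spine (T w).
Proof.
move=> nb; have vE v : odflt [::] (unpickle (pickle v)) = v :> seq nat by rewrite pickleK.
by split=> v; [move=> a1|move=> sp a0]; apply: nb;
  exists (pickle v) => //; rewrite /mkset vE; [left|right].
Qed.

(** Off a null set, if the tree represents [f], then so does the pattern for every large depth [j]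
    and, once [j] is fixed, for every large cap. Two nested lower limits preserve the bound. *)
Lemma Pk_le f (m0 : nat) (B : R) :
  (forall N j, (m0 <= N)%N ->
    \sum_(s : pat k N j.*2.+1 | pfun true s == f) wt (@capped R mu N) true s <= B) ->
  (Pk P T f <= B%:E)%E.
Proof.
move=> HB; rewrite /Pk.
pose E j n := [set w | pfun true (trunc (m0 + n) j.*2.+1 (T w) [::]) == f].
have EP j n : measurable (E j n) /\ (P (E j n) <= B%:E)%E.
  have [mE PE] := prob_trunc_le HT k_gt0 (fun s : pat k (m0 + n) j.*2.+1 => pfun true s == f).
  by split=> //; apply: le_trans PE _; rewrite lee_fin HB // leq_addr.
have EjP j := prob_liminf_le (fun n => (EP j n).1) (fun n => (EP j n).2).
have [mL PL] := prob_liminf_le (fun j => (EjP j).1) (fun j => (EjP j).2).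
set L := \bigcup_n _ in mL PL.
have [mbad Pbad] := degenerate_null.
apply: (@le_trans _ _ (P (degenerate `|` L))).
  apply: le_measure.
  - exact/mem_set/measurable_represents.
  - exact/mem_set/measurableU.

  - move=> w /= wf; have [wb|/not_degenerate[w1 wsp]] := pselect (degenerate w); first by left.
  right; have [h0 Hh0] := represents_fill i0 w1 wf.
  exists h0 => // j /= h0j.
  have [M0 HM0] := arity_bounded_ex j.*2.+1 (T w) [::].
  exists M0 => // n /= M0n; apply/eqP.
  have ab : arity_bounded (m0 + n).+2 j.*2.+1 (T w) [::] by apply: HM0; lia.
  have ht : (h0 < j.*2.+1)%N by lia.
  by rewrite -(Hh0 _ ht) -(pfun_trunc i0 w1 wsp ab).
apply: (@le_trans _ _ (P degenerate + P L)%E); first exact: measureU2.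
by rewrite Pbad add0e.
Qed.

End Upper_bound.

(** * Partial trees *)

Section Partial_trees.
Variable k : nat.

(* Finite pieces of a labelled tree; nothing is known about the subtree in place
   of a [Hole]. *)
Inductive ptree : Type :=
| Hole
| PLeaf of literal k
| PNode of connective & seq ptree.

Lemma ptree_nested_ind (Q : ptree -> Prop) :
  Q Hole -> (forall l, Q (PLeaf l)) ->
  (forall c ps, (forall i, (i < size ps)%N -> Q (nth Hole ps i)) -> Q (PNode c ps)) ->
  forall p, Q p.
Proof.
move=> QH QL QN; fix IH 1 => -[|l|c ps]; [exact: QH|exact: QL|].
apply: QN; elim: ps => [i|p ps IHps [_|i Hi]]; first by clear IH; rewrite ltn0.
  exact: (IH p).
exact: (IHps i Hi).
Qed.

(** Three-valued evaluation: the explicit part already settles the value [b]. One child is enough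
    when [b] is absorbing for the gate. *)
Fixpoint forces (x : {ffun 'I_k -> bool}) (p : ptree) (b : bool) : bool :=
  match p with
  | Hole => false
  | PLeaf l => (x l.1 == l.2) == b
  | PNode c ps => if is_conj c == b then all (fun p => forces x p b) ps
                  else has (fun p => forces x p b) ps
  end.

Fixpoint matches (t : ltree k) (v : seq nat) (p : ptree) : Prop :=
  match p with
  | Hole => True
  | PLeaf l => arity t v = 0%N /\ lit t v = l
  | PNode c ps => [/\ arity t v = size ps, gate t v = c &
      (fix loop i ps := if ps is p :: ps' then matches t (rcons v i) p /\ loop i.+1 ps'
                        else True) 0%N ps]
  end.

Lemma matches_PNode t v c ps : matches t v (PNode c ps) <->
  [/\ arity t v = size ps, gate t v = c &
    forall i, (i < size ps)%N -> matches t (rcons v i) (nth Hole ps i)].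
Proof.
suff loopP j : (fix loop i ps := if ps is p :: ps' then matches t (rcons v i) p /\ loop i.+1 ps'
    else True) j ps <-> forall i, (i < size ps)%N -> matches t (rcons v (j + i)%N) (nth Hole ps i).
  by split=> -[aE gE /(loopP 0%N) H].
elim: ps j => [|p ps IH] j; first by split.
split=> [[mp /IH H] [|i] Hi|H]; first by rewrite addn0.
  by rewrite addnS -addSn; apply: H.
split; first by have := H 0%N isT; rewrite addn0.
by apply/IH => i Hi; rewrite addSn -addnS; apply: (H i.+1).
Qed.

Fixpoint height (p : ptree) : nat :=
  if p is PNode _ ps then (foldr maxn 0 (map height ps)).+1 else 0%N.

Lemma height_child c ps i : (i < size ps)%N -> (height (nth Hole ps i) < height (PNode c ps))%N.
Proof.
rewrite /= ltnS; elim: ps i => [|p ps IH] [|i] //= Hi; first exact: leq_maxl.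
exact: leq_trans (IH i Hi) (leq_maxr _ _).
Qed.

(** Holes impose nothing, so they cost no probability and are not counted. *)
Fixpoint nodes (p : ptree) : nat :=
  match p with Hole => 0 | PLeaf _ => 1 | PNode _ ps => (sumn (map nodes ps)).+1 end.

Variable m : nat.
Hypothesis m_ge2 : (2 <= m)%N.

(* [b] tells whether the root is on the spine. *)
Fixpoint m_ary (b : bool) (p : ptree) : bool :=
  match p with
  | Hole => true
  | PLeaf _ => ~~ b
  | PNode _ ps => (size ps == m) &&
      (if ps is p :: ps' then m_ary b p && all (m_ary false) ps' else true)
  end.

Lemma m_ary_child b c ps i : m_ary b (PNode c ps) -> (i < size ps)%N ->
  m_ary (b && (i == 0%N)) (nth Hole ps i).
Proof.
case: ps => [|p ps] //= /andP[_ /andP[mp mps]]; case: i => [|i] Hi /=.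
  by rewrite andbT.
by rewrite andbF; move/all_nthP: mps; apply.
Qed.

(** Here [b] is a truth value and [b'] the spine flag. A forced value reads only explicit vertices,
    where [s] agrees with [t]. *)
Lemma eval_matches x b b' h t v p s : m_ary b' p -> matches t v p ->
  coincide h t v s -> (height p <= h)%N -> forces x p b -> eval x s = b.
Proof.
elim/ptree_nested_ind: p b' h v s => [//|l|c ps IH] b' h v s mp.
  move=> [a0 lE]; case: s => [l'|c s1 s2 ss].
    by case: h => [|h] [_ l'E] _ /=; rewrite -l'E lE => /eqP.
  by case: h => [|h] []; rewrite a0.
move=> /matches_PNode[aE gE H]; have sm : size ps = m by case/andP: mp => /eqP.
case: s => [l'|c' s1 s2 ss].
  by case: h => [|h] []; rewrite aE sm => m0; move: m_ge2; rewrite m0.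
case: h => [|h]; first by [].
move=> [a0 gE' [aE' Hc]] hp; rewrite gE in gE'; subst c'.
rewrite eval_Node; set ch := [:: s1, s2 & ss] in aE' Hc *.
have sz : size ps = size ch by rewrite -aE.
have evalE i : (i < size ps)%N -> forces x (nth Hole ps i) b ->
    eval x (nth (Node c s1 s2 ss) ch i) = b.
  move=> Hi; apply: (IH i Hi _ h (rcons v i)); first exact: m_ary_child mp Hi.
  - exact: H.
  - by apply: Hc; rewrite aE.
  - by rewrite -ltnS; apply: leq_trans hp; apply: height_child.
rewrite [forces _ _ _]/=; case: eqP => cb fp.
  have allb y : y \in map (eval x) ch -> y = b.
    move=> /(nthP false)[i]; rewrite size_map => Hi <-.
    rewrite (nth_map (Node c s1 s2 ss)) //; rewrite -sz in Hi; apply: evalE => //.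
    by move/(all_nthP Hole): fp; apply.
  have {}cb : b = is_conj c by [].
  case: c cb {mp gE evalE H IH hp fp Hc} => cb.
    by rewrite cb; apply/allP => y /allb ->; rewrite cb.
  by rewrite cb; apply/negbTE/hasPn => y /allb ->; rewrite cb.
have {fp} : b \in map (eval x) ch.
  move/(has_nthP Hole): fp => [i Hi fi]; rewrite -(evalE i Hi fi) -(nth_map _ false) -?sz //.
  by rewrite mem_nth // size_map -sz.
have -> : b = ~~ is_conj c by move: cb; clear; case: (is_conj c); case: b.
exact: gate_eval_absorbing.
Qed.

Lemma represents_matches (f : boolfun k) t p : no_unary t -> 'I_k -> m_ary true p ->
  matches t [::] p -> (forall x, forces x p (f x)) -> represents t f.
Proof.
move=> t1 i0 mp tp fp; exists (height p); split.
  by exists (fill i0 (height p).+1 t [::]); apply: coincide_fill.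
move=> s sc; apply/ffunP => x; rewrite ffunE.
exact: (eval_matches mp tp sc (leqnn _) (fp x)).
Qed.

Variable i0 : 'I_k.

Definition dual_conn c := if c is Conj then Disj else Conj.

(* Evaluates to the neutral element of c. *)
Definition neutral c : ptree := PNode (dual_conn c)
  [:: PLeaf (i0, true), PLeaf (i0, false) & nseq (m - 2) (PLeaf (i0, true))].

(** The padding brings the arity to [m] without affecting the value. *)
Definition binary c p q : ptree := PNode c [:: p, q & nseq (m - 2) (neutral c)].

Fixpoint m_ary_tree (t : aotree k) : ptree :=
  match t with
  | Leaf l => PLeaf l
  | Node c t1 t2 ts =>
      foldl (binary c) (binary c (m_ary_tree t1) (m_ary_tree t2)) (map m_ary_tree ts)
  end.

Lemma forces_neutral x c : forces x (neutral c) (is_conj c).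
Proof. by case: c => /=; case: (x i0). Qed.

Lemma forces_binary x c p q a b : forces x p a -> forces x q b ->
  forces x (binary c p q) (if is_conj c then a && b else a || b).
Proof.
move=> fp fq; rewrite /binary [forces _ _ _]/=; have fn := forces_neutral x c.
case: c fn => fn; case: a fp; case: b fq => fq fp; rewrite /= ?fp ?fq ?orbT //=;
  by rewrite all_nseq; apply/orP; right.
Qed.

Lemma foldl_binary_forces x c p a qs bs : forces x p a ->
  size qs = size bs -> (forall i, (i < size qs)%N -> forces x (nth Hole qs i) (nth false bs i)) ->
  forces x (foldl (binary c) p qs)
    (foldl (fun a b => if is_conj c then a && b else a || b) a bs).
Proof.
elim: qs p a bs => [|q qs IH] p a [|b bs] //= fp [sE] H.
apply: IH => // [|i Hi]; last exact: (H i.+1).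
by apply: forces_binary => //; apply: (H 0%N).
Qed.

Lemma foldl_gate c a bs : foldl (fun a b => if is_conj c then a && b else a || b) a bs =
  gate_eval c (a :: bs).
Proof.
elim: bs a => [|b bs IH] a /=.
  by rewrite gate_eval_cons gate_eval_nil; case: c; rewrite ?andbT ?orbF.
by rewrite IH !gate_eval_cons; case: c {IH} => /=; rewrite ?andbA ?orbA.
Qed.

Lemma forces_m_ary_tree x t : forces x (m_ary_tree t) (eval x t).
Proof.
elim/aotree_nested_ind: t => [l|c t1 t2 ts IH] /=; first by rewrite eqxx.
rewrite -[match c with Conj => _ | Disj => _ end]/(eval x (Node c t1 t2 ts)) eval_Node.
have -> : gate_eval c (map (eval x) [:: t1, t2 & ts]) = gate_eval c
    ((if is_conj c then eval x t1 && eval x t2 else eval x t1 || eval x t2) :: map (eval x) ts).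
  by rewrite /= !gate_eval_cons; case: c {IH} => /=; rewrite ?andbA ?orbA.
rewrite -foldl_gate; apply: foldl_binary_forces; rewrite ?size_map //.
  by apply: forces_binary; [exact: (IH 0%N)|exact: (IH 1%N)].
by move=> i Hi; rewrite !(nth_map t1) //; apply: (IH i.+2).
Qed.

Lemma m_ary_neutral c : m_ary false (neutral c).
Proof.
rewrite /= size_nseq; apply/andP; split; first by apply/eqP; lia.
by rewrite all_nseq orbT.
Qed.

Lemma m_ary_binary b c p q : m_ary b p -> m_ary false q -> m_ary b (binary c p q).
Proof.
move=> mp mq; rewrite /= mp mq size_nseq; apply/andP; split; first by apply/eqP; lia.
by rewrite all_nseq m_ary_neutral orbT.
Qed.

Lemma m_ary_m_ary_tree t : m_ary false (m_ary_tree t).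
Proof.
elim/aotree_nested_ind: t => [//|c t1 t2 ts IH] /=.
have : m_ary false (binary c (m_ary_tree t1) (m_ary_tree t2)).
  by apply: m_ary_binary; [exact: (IH 0%N)|exact: (IH 1%N)].
have {IH} : forall i, (i < size ts)%N -> m_ary false (m_ary_tree (nth t1 ts i)).
  by move=> i Hi; apply: (IH i.+2).
elim: ts (binary _ _ _) => //= t ts IHts p Hts mp; apply: IHts => [i Hi|].
  exact: (Hts i.+1).
by apply: m_ary_binary => //; apply: (Hts 0%N).
Qed.

(** The gate itself and [m - 2] neutral trees of [m.+1] vertices each. *)
Let D := ((m - 2) * m.+1).+1.

Lemma nodes_binary c p q : nodes (binary c p q) = (nodes p + nodes q + D)%N.
Proof.
have sumn_nseq_leaf n : sumn (nseq n 1%N) = n by elim: n => //= n ->.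
rewrite /= !map_nseq /= !map_nseq /= sumn_nseq_leaf.
have -> n a : sumn (nseq n a) = (n * a)%N by elim: n => //= n ->; rewrite mulSn.
rewrite /D; have -> : (1 + (1 + (m - 2))).+1 = m.+1 by lia.
lia.
Qed.

(** A tree with [L] leaves unfolds into [L - 1] two-input gates, each costing [D] further
    vertices. *)
Lemma nodes_m_ary_tree t : (nodes (m_ary_tree t) + D = D.+1 * leaves t)%N.
Proof.
elim/aotree_nested_ind: t => [l|c t1 t2 ts IH] /=; first by rewrite muln1.
have IH1 := IH 0%N isT; have IH2 := IH 1%N isT; rewrite /= in IH1 IH2.
have base : (nodes (binary c (m_ary_tree t1) (m_ary_tree t2)) + D =
    D.+1 * (leaves t1 + leaves t2))%N by rewrite nodes_binary; lia.
have {}IH : forall i, (i < size ts)%N ->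
    (nodes (m_ary_tree (nth t1 ts i)) + D = D.+1 * leaves (nth t1 ts i))%N.
  by move=> i Hi; apply: (IH i.+2).
elim: ts (binary _ _ _) (leaves t1 + leaves t2)%N base IH => [|t ts IHts] p n /= pn H.
  by rewrite addn0.
rewrite addnA; apply: IHts => [|i Hi]; last exact: (H i.+1).
by rewrite nodes_binary; have /= := H 0%N isT; lia.
Qed.

(* Two spine vertices labelled [\/], one with the leaf [x_i0] and the other with
   the leaf [~ x_i0]: the value is True whatever hangs further up the spine. *)
Definition true_spine : ptree :=
  let xs := nseq (m - 2) (PLeaf (i0, true)) in
  PNode Disj [:: PNode Disj [:: Hole, PLeaf (i0, false) & xs], PLeaf (i0, true) & xs].

Lemma forces_true_spine x : forces x true_spine true.
Proof. by rewrite /=; case: (x i0); rewrite ?orbT. Qed.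

Lemma m_ary_true_spine : m_ary true true_spine.
Proof.
have mx : all (m_ary false) (nseq (m - 2) (PLeaf (i0, true))).
  by rewrite all_nseq orbT.
rewrite /= !size_nseq mx !andbT; have -> : (m - 2).+2 = m by lia.
by rewrite eqxx.
Qed.

Lemma nodes_true_spine : nodes true_spine = (2 * m)%N.
Proof.
have sumn_nseq_leaf n : sumn (nseq n 1%N) = n by elim: n => //= n ->.
rewrite /= !map_nseq sumn_nseq_leaf; lia.
Qed.

(** Conjunction with a true spine leaves the value of the grafted tree. [maxn 1] and the factor 2
    cover the constants, of complexity 0 but represented by a tree with two leaves. *)
Lemma small_representing_ptree (f : boolfun k) : exists p,
  [/\ m_ary true p, forall x, forces x p (f x) &
      (nodes p <= (2 * m + 2 * D.+1) * maxn 1 (complexity f))%N].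
Proof.
have [t tf lt] : exists2 t, fun_of_tree t = f & (leaves t <= 2 * maxn 1 (complexity f))%N.
  have [[b fb]|fnc] := pselect (constant_fun f).
    exists (Node (conn (~~ b)) (Leaf (i0, true)) (Leaf (i0, false)) [::]) => /=; last lia.
    by apply/ffunP => x; rewrite fb ffunE; case: b fb => /=; case: (x i0).
  have [t0 t0f] := fun_of_tree_surj i0 f.
  by have [t tf tl] := complexity_witness t0f fnc; exists t => //; rewrite tl; lia.
exists (binary Conj true_spine (m_ary_tree t)); split.
- by apply: m_ary_binary; [exact: m_ary_true_spine|exact: m_ary_m_ary_tree].
- move=> x; have -> : f x = true && eval x t by rewrite -tf ffunE.
  exact: (forces_binary Conj (forces_true_spine x) (forces_m_ary_tree x t)).
rewrite nodes_binary nodes_true_spine -addnA nodes_m_ary_tree; nia.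
Qed.

End Partial_trees.

(** * The lower bound *)

Section Lower_bound.
Variables (R : realType) (mu : nat -> R) (k : nat) (d : measure_display).
Variables (Omega : measurableType d) (P : probability Omega R) (T : Omega -> ltree k).
Hypothesis HT : random_labelled_Tinfty (fun n => (mu n)%:E) P T.
Hypothesis k_ge2 : (2 <= k)%N.
Hypothesis mu_ge0 : forall n, 0 <= mu n.
Hypothesis mu1 : mu 1%N = 0.
Variable m : nat.
Hypothesis m_ge2 : (2 <= m)%N.
Variable c : R.
Hypothesis c_gt0 : 0 < c.
Hypothesis c_mu0 : 2 * c <= mu 0%N.
Hypothesis c_mum : 2 * c <= mu m.

Let k_gt0 : (0 < k)%N := ltnW k_ge2.

(** Each explicit vertex costs a factor at least [c / k]: a leaf has [mu 0 / (2 * k)] and an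
    internal vertex at least [mu m / 2], size-biasing only increasing the latter. *)
Lemma prob_matches v (p : ptree k) : m_ary m (on_spine v) p ->
  cyl T (below v) [set w | matches (T w) v p] /\
  (c / k%:R) ^+ nodes p <= fine (P [set w | matches (T w) v p]).
Proof.
have kR : 0 < k%:R :> R by rewrite ltr0n.
have ck0 : 0 <= c / k%:R by rewrite divr_ge0 ?ltW.
have PT : P [set: Omega] = 1%E by exact: probability_setT.
elim/ptree_nested_ind: p v => [|l|g ps IH] v.
- move=> _; have -> : [set w | matches (T w) v (Hole k)] = setT by apply/seteqP; split.
  by rewrite PT; split; [exact: cyl_setT|rewrite expr0].
- move=> /= nsp; pose E (i : nat) : set Omega := setT.
  have cE i : (i < 0)%N -> cyl T (below (rcons v i)) (E i) by [].
  have [c1 P1] := cyl_node HT (eq^~ 0%N) setT (eq^~ l) cE.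
  have -> : [set w | arity (T w) v = 0%N /\ lit (T w) v = l] =
    [set w | arity (T w) v = 0%N] `&` ([set w | [set: connective] (gate (T w) v)] `&`
    ([set w | lit (T w) v = l] `&` \big[setI/[set: Omega]]_(i < 0) E i)).
    rewrite big_ord0; apply/seteqP; split=> w /=; first by case.
    by case=> a0 [_ [lE _]].
  split=> //; rewrite P1 big_ord0 (prob_arity HT) (negbTE nsp) /offspring.
  have -> : [set w | [set: connective] (gate (T w) v)] = setT by apply/seteqP; split.
  have -> : P [set w | lit (T w) v = l] = ((2 * k)%N%:R^-1)%:E by case: HT => _ _ _ _ ->.
  rewrite PT mule1 mul1e -EFinM /= expr1 natrM invfM mulrA ler_pM2r ?invr_gt0 //.
  by rewrite ler_pdivlMr // mulrC.
move=> mp; have sm : size ps = m by case/andP: mp => /eqP.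
pose E i := [set w | matches (T w) (rcons v i) (nth (Hole k) ps i)].
have spE i : on_spine (rcons v i) = on_spine v && (i == 0%N).
  by rewrite /on_spine all_rcons /= andbC.
have HE i : (i < m)%N -> cyl T (below (rcons v i)) (E i) /\
    (c / k%:R) ^+ nodes (nth (Hole k) ps i) <= fine (P (E i)).
  by rewrite -sm => Hi; apply: IH => //; rewrite spE; apply: m_ary_child mp Hi.
have [c1 P1] := cyl_node HT (eq^~ m) (eq^~ g) setT (fun i Hi => (HE i Hi).1).
have -> : [set w | matches (T w) v (PNode g ps)] =
    [set w | arity (T w) v = m] `&` ([set w | gate (T w) v = g] `&`
    ([set w | [set: literal k] (lit (T w) v)] `&` \big[setI/[set: Omega]]_(i < m) E i)).
  rewrite -bigcap_mkord; apply/seteqP; split=> w.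
    by case/matches_PNode => aE gE H; rewrite -sm; split.
  by case=> /= aE [gE [_ H]]; apply/matches_PNode; rewrite sm; split.
split=> //; rewrite P1 (prob_arity HT).
have -> : [set w | [set: literal k] (lit (T w) v)] = setT by apply/seteqP; split.
have -> : P [set w | gate (T w) v = g] = (2^-1)%:E by case: HT => _ _ _ ->.
rewrite (eq_bigr (fun i : 'I_m => (fine (P (E i)))%:E)); last first.
  move=> i _; rewrite fineK //; apply: fin_num_measure.
  exact: cyl_measurable HT _ _ (HE i (ltn_ord i)).1.
rewrite PT mul1e prodEFin -!EFinM [fine _]/= [nodes _]/= exprS.
have prod_le : (c / k%:R) ^+ sumn (map (@nodes k) ps) <= \prod_(i < m) fine (P (E i)).
  rewrite sumnE big_map (big_nth (Hole k)) sm big_mkord expr_sum.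
  by apply: ler_prod => i _; rewrite exprn_ge0 //=; case: (HE i (ltn_ord i)).
rewrite mulrA ler_pM ?exprn_ge0 //.
have mum : mu m <= offspring mu (on_spine v) m.
  by rewrite /offspring; case: ifP => // _; rewrite ler_peMl // ler1n ltnW.
apply: (@le_trans _ _ c); first by rewrite ler_pdivrMr // ler_peMr ?(ltW c_gt0) // ler1n.
by rewrite ler_pdivlMr // mulrC; apply: le_trans mum.
Qed.

Lemma Pk_ge (f : boolfun k) (p : ptree k) : m_ary m true p -> (forall x, forces x p (f x)) ->
  (((c / k%:R) ^+ nodes p)%:E <= Pk P T f)%E.
Proof.
move=> mp fp; have [cE PE] := prob_matches (v := [::]) mp.
have mE := cyl_measurable HT cE; set E := [set w | _] in cE PE mE.
apply: (@le_trans _ _ (P E)).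
  by rewrite -(fineK (fin_num_measure P E mE)) lee_fin.
have [mbad Pbad] := degenerate_null HT mu1.
have mf := measurable_represents HT k_gt0 f.
apply: (@le_trans _ _ (P (degenerate T) + Pk P T f)%E); last by rewrite Pbad add0e.
apply: (@le_trans _ _ (P (degenerate T `|` [set w | represents (T w) f]))).
  apply: le_measure; [exact/mem_set|exact/mem_set/measurableU|].
  move=> w Ew; have [wb|/not_degenerate[w1 _]] := pselect (degenerate T w); [by left|right].
  exact: (represents_matches m_ge2 w1 (Ordinal k_gt0) mp Ew fp).
exact: measureU2.
Qed.

Lemma Pk_ge_complexity (K : nat) (f : boolfun k) : (forall g : boolfun k, exists p,
    [/\ m_ary m true p, forall x, forces x p (g x) &
        (nodes p <= K * maxn 1 (complexity g))%N]) ->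
  c <= 2^-1 ->
  ((expR (- (K%:R * (1 - ln c / ln 2)) * (maxn 1 (complexity f))%:R * ln k%:R))%:E
    <= Pk P T f)%E.
Proof.
move=> H c1; have [p [mp fp np]] := H f; apply: le_trans (Pk_ge mp fp); rewrite lee_fin.
have kR : 0 < k%:R :> R by rewrite ltr0n.
have ck0 : 0 < c / k%:R by rewrite divr_gt0.
have ck1 : c / k%:R <= 1.
  by rewrite ler_pdivrMr // mul1r (le_trans c1) // (le_trans (_ : _ <= 1)) ?ler1n //; lra.
set M := maxn 1 (complexity f) in np *.
apply: (@le_trans _ _ ((c / k%:R) ^+ (K * M))); last exact: ler_wiXn2l (ltW ck0) ck1 _ _ np.
(* As [ln c <= 0] and [ln 2 <= ln k], [ln c] is at least [ln c / ln 2 * ln k]: the constant [c] is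
   absorbed into a power of [k]. *)
rewrite -[X in _ <= X ^+ _]lnK ?posrE // -expRM_natl ler_expR natrM.
have ln2 : 0 < ln 2 :> R by rewrite ln_gt0 // ltr1n.
have lnk : ln 2 <= ln k%:R :> R by rewrite ler_ln ?posrE // ler_nat.
have lnc : ln c <= 0 by rewrite ln_le0 //; lra.
rewrite ln_div ?posrE //.
rewrite (_ : - _ * _ * _ = (K%:R * M%:R) * ((ln c / ln 2 - 1) * ln k%:R)); last by ring.
rewrite ler_wpM2l // mulrBl mul1r lerD2r mulrAC ler_pdivrMr //.
by rewrite ler_wnM2l.
Qed.

End Lower_bound.

(** * The offspring law *)

Section Offspring_law.
Variables (R : realType) (d0 : measure_display) (Omega0 : measurableType d0).
Variables (P0 : probability Omega0 R) (xi : {RV P0 >-> nat}).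

Definition pmf (n : nat) : R := fine (P0 [set w | xi w = n]).

Lemma measurable_xi (A : set nat) : measurable [set w | A (xi w)].
Proof. exact: (measurable_funPTI xi (Y := A)). Qed.

Lemma pmfE n : P0 [set w | xi w = n] = (pmf n)%:E.
Proof. by rewrite fineK // fin_num_measure //; apply: (measurable_xi (eq^~ n)). Qed.

Lemma pmf_ge0 n : 0 <= pmf n.
Proof. by rewrite -lee_fin -pmfE. Qed.

Lemma expectation_series (g : nat -> R) : (forall n, 0 <= g n) ->
  'E_P0[(fun w => g (xi w))]%E = (\sum_(0 <= n <oo) (g n * pmf n)%:E)%E.
Proof.
move=> g0; rewrite unlock.
have -> : [set: Omega0] = \bigcup_n [set w | xi w = n].
  by apply/seteqP; split=> // w _; exists (xi w).
rewrite ge0_integral_bigcup //.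
- apply: eq_eseriesr => n _.
  transitivity (\int[P0]_(w in [set w | xi w = n]) cst (g n)%:E w)%E.
    by apply: eq_integral => w /set_mem /= ->.
  rewrite integral_cst; last exact: (measurable_xi (eq^~ n)).
  by rewrite EFinM; congr (_ * _)%E; apply: pmfE.
- by move=> n; apply: (measurable_xi (eq^~ n)).
- move=> mD B mB; apply: measurableI => //.
  exact: (measurable_xi (fun n => B (g n)%:E)).
- by move=> w _; rewrite lee_fin.
- by move=> i j _ _ [w [/= <- <-]].
Qed.

Lemma sum_le_expectation (g : nat -> R) (B : R) M : (forall n, 0 <= g n) ->
  ('E_P0[(fun w => g (xi w))] <= B%:E)%E -> \sum_(n < M) g n * pmf n <= B.
Proof.
move=> g0; rewrite expectation_series // => /(le_trans _) H.
rewrite -lee_fin; apply: H; rewrite -sumEFin -(big_mkord xpredT (fun n => (g n * pmf n)%:E)).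
by apply: nneseries_lim_ge => n _ _; rewrite lee_fin mulr_ge0 ?pmf_ge0.
Qed.

Hypothesis xi_mean : ('E_P0[(fun w => (xi w)%:R)%R] = 1)%E.
Hypothesis xi_neq1 : P0 [set w | xi w = 1%N] = 0%E.

Lemma pmf1 : pmf 1 = 0. Proof. by rewrite /pmf xi_neq1. Qed.

Lemma mean_series : (\sum_(0 <= n <oo) (n%:R * pmf n)%:E)%E = 1%:E.
Proof. by rewrite -(expectation_series (g := fun n => n%:R)). Qed.

Lemma total_series : (\sum_(0 <= n <oo) (1 * pmf n)%:E)%E = 1%:E.
Proof. by rewrite -(expectation_series (g := fun=> 1)) // expectation_cst. Qed.

(** Otherwise all the mass would be at 0, since 1 has none, and the mean would be 0. *)
Lemma pmf_large : exists2 m, (2 <= m)%N & 0 < pmf m.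
Proof.
apply: contrapT => H; have : (0%E : \bar R) = 1%:E; last by case=> /eqP; rewrite eq_sym oner_eq0.
rewrite -mean_series eseries0 // => -[|[|n]] _ _; rewrite ?mul0r ?pmf1 ?mulr0 //.
suff -> : pmf n.+2 = 0 by rewrite mulr0.
apply/eqP; rewrite eq_le pmf_ge0 andbT leNgt; apply/negP => pn.
by apply: H; exists n.+2.
Qed.

(** Otherwise [xi] would be at least 2 almost surely, against the mean 1. *)
Lemma pmf0_gt0 : 0 < pmf 0.
Proof.
rewrite lt_neqAle pmf_ge0 andbT; apply/negP => /eqP p0.
have : (2%:E * (\sum_(0 <= n <oo) (1 * pmf n)%:E) <= (\sum_(0 <= n <oo) (n%:R * pmf n)%:E))%E.
  rewrite -nneseriesZl; last by move=> n _; rewrite lee_fin mul1r pmf_ge0.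
  apply: lee_nneseries => [n _ _|[|[|n]] _]; rewrite -EFinM lee_fin mul1r.
  - by rewrite mulr_ge0 ?pmf_ge0.
  - by rewrite -p0 !mulr0.
  - by rewrite pmf1 !mulr0.
  - by rewrite ler_wpM2r ?pmf_ge0 // ler_nat.
rewrite mean_series total_series mule1 lee_fin; lra.
Qed.

End Offspring_law.

Theorem theorem4p2 (R : realType) (d0 : measure_display)
    (Omega0 : measurableType d0) (P0 : probability Omega0 R)
    (xi : {RV P0 >-> nat})
    (xi_mean : ('E_P0[(fun w => (xi w)%:R)%R] = 1)%E)
    (xi_neq1 : P0 [set w | xi w = 1%N] = 0%E)
    (xi_exp : exists2 a : R, 0 < a &
       ('E_P0[(fun w => expR (a * (xi w)%:R))%R] < +oo)%E) :
  exists c1 c2 : R,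
    [/\ 0 < c1, 0 < c2 &
      forall (k : nat) (f : boolfun k), (2 <= k)%N ->
      forall (d : measure_display) (Omega : measurableType d)
        (P : probability Omega R) (T : Omega -> ltree k),
      random_labelled_Tinfty (fun n => P0 [set w | xi w = n]) P T ->
      ((expR (- c1 * (maxn 1 (complexity f))%:R * ln k%:R))%:E <= Pk P T f)%E
      /\
      (Pk P T f <= (expR (- c2 * (complexity f)%:R * k%:R ^- 2
                          - ln ('C(k, Ess f))%:R))%:E)%E].
Proof.
case: xi_exp => a a0 Ea; have [m m2 pm] := pmf_large xi_mean xi_neq1.
have p0 := pmf0_gt0 xi_mean xi_neq1; have p1 := pmf1 xi_neq1.
set mu := pmf xi in pm p0 p1; have mu_ge0 : forall n, 0 <= mu n by exact: pmf_ge0.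
have [B EB] : exists B : R, 'E_P0[(fun w => expR (a * (xi w)%:R))%R]%E = B%:E.
  exists (fine 'E_P0[(fun w => expR (a * (xi w)%:R))%R]%E); rewrite fineK // ge0_fin_numE //.
  by rewrite unlock; apply: integral_ge0 => w _; rewrite lee_fin expR_ge0.
have mu_sum M : \sum_(n < M) mu n <= 1.
  rewrite (eq_bigr (fun n : 'I_M => (fun=> 1) n * mu n)); last by move=> *; rewrite mul1r.
  by apply: (sum_le_expectation (g := fun=> 1)) => //; rewrite expectation_cst.
have mu_mean M : \sum_(n < M) n%:R * mu n <= 1.
  by apply: (sum_le_expectation (g := fun n => n%:R)) => //; rewrite xi_mean.
have mu_exp M : \sum_(n < M) mu n * expR (a * n%:R) <= B.
  rewrite (eq_bigr (fun n : 'I_M => expR (a * n%:R) * mu n)); last by move=> *; rewrite mulrC.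
  apply: (sum_le_expectation (g := fun n => expR (a * n%:R))) => [n|]; first exact: expR_ge0.
  by rewrite EB.
have [c2 c2_gt0 tail] := tail_bound mu_ge0 mu_sum mu_mean a0 mu_exp p0 pm m2.
(* The division by 2 pays for the gate at an internal vertex and for the sign of the literal at a
   leaf. *)
pose c : R := Num.min (mu 0%N) (mu m) / 2.
have c_gt0 : 0 < c by rewrite divr_gt0 // lt_min p0 pm.
have c_mu0 : 2 * c <= mu 0%N by rewrite /c mulrC divfK // ge_min lexx.
have c_mum : 2 * c <= mu m by rewrite /c mulrC divfK // ge_min lexx orbT.
have c_le : c <= 2^-1.
  have : mu 0%N <= 1 by have := mu_sum 1%N; rewrite big_ord1.
  by move: c_mu0; lra.
have ln2 : 0 < ln 2 :> R by rewrite ln_gt0 // ltr1n.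
(* The factor in [small_representing_ptree], with [D] unfolded. *)
pose K := (2 * m + 2 * ((m - 2) * m.+1).+2)%N.
exists (K%:R * (1 - ln c / ln 2)), c2; split=> //.
  rewrite mulr_gt0 ?ltr0n //; first by rewrite /K; lia.
  have : ln c / ln 2 <= 0.
    by rewrite pmulr_lle0 ?invr_gt0 // ln_le0 // (le_trans c_le) //; lra.
  lra.
move=> k f k2 d Omega P T; rewrite (_ : (fun n => _) = fun n => (mu n)%:E); last first.
  by apply/funext => n; exact: pmfE.
move=> HT; have k0 : (0 < k)%N by lia.
pose i0 : 'I_k := Ordinal k0; split.
  apply: (Pk_ge_complexity HT k2 mu_ge0 p1 m2 c_gt0 c_mu0 c_mum (K := K)) => // g.
  exact: (small_representing_ptree m2 i0).
have C0 : (0 < 'C(k, Ess f))%N.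
  by rewrite bin_gt0 -[leqRHS]card_ord; apply: max_card.
have C0R : 0 < 'C(k, Ess f)%:R :> R by rewrite ltr0n.
(* Caps with [N >= m] keep the arity [m], which killing requires. *)
apply: (Pk_le HT k0 p1 (m0 := m)) => N j mN.
have mN3 : (m < N.+3)%N by lia.
rewrite expRD expRN lnK ?posrE // ler_pdivlMr // mulrC.
have capped_ge := @capped_ge0 _ _ mu_ge0 mu_sum mu_mean N.
apply: le_trans (binomial_pfun_le m2 capped_ge i0 j f) _.
exact: tail.
Qed.
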